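(* Let $a,b,c,a',b',c'$ be non-negative integers, let $X,Y\subseteq[a+b]$ and $X',Y'\subseteq[a'+b']$, and suppose that: (1) $(X',Y')$ is a shuffling of $(X,Y)$, i.e. $X\cup Y=X'\cup Y'$ and $X\cap Y=X'\cap Y'$; (2) $a+b=a'+b'$ and $b+c=b'+c'$; (3) $a+b\ge c$ and $a'+b'\ge c'$; (4) $b-|X|=c-|Y|=b'-|X'|=c'-|Y'|\ge 0$, and $b-|X|\le |[a+b]\setminus(X\cup Y)|$. Then, with $q$ an indeterminate, $$\frac{M(V_{a',b',c'}(X',Y');q)}{M(V_{a,b,c}(X,Y);q)}=q^{\alpha}\,\frac{\Delta_{1,q}([b])\,\Delta_{1,q}([c])}{\Delta_{1,q}([b'])\,\Delta_{1,q}([c'])}\cdot\frac{\Delta_{1,q}(X')\,\Delta_{1,q}(Y')}{\Delta_{1,q}(X)\,\Delta_{1,q}(Y)},$$ where $$\alpha=\Big[\sum_{i'\in X'}i'-(b'+c')\sum_{j'\in Y'}j'-\tfrac{b'(b'+1)}{2}+(a'+b'+1)(b'+1)c'-\tfrac{(b'+1)c'(c'+1)}{2}+\tfrac{(a'+b'+1)c'(c'-1)}{2}\Big]$$ $$\qquad-\Big[\sum_{i\in X}i-(b+c)\sum_{j\in Y}j-\tfrac{b(b+1)}{2}+(a+b+1)(b+1)c-\tfrac{(b+1)c(c+1)}{2}+\tfrac{(a+b+1)c(c-1)}{2}\Big].$$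
   Context: Work on the triangular lattice drawn so that one family of lattice lines is horizontal. A lozenge is the union of two unit triangles sharing an edge; a lozenge tiling of a region is a set of lozenges covering it without overlap. There are three kinds of lozenges: a vertical-lozenge consists of an up-pointing unit triangle and the down-pointing unit triangle directly below it sharing its horizontal base; a right-lozenge consists of an up-pointing unit triangle and the down-pointing unit triangle immediately to its right (so it is a parallelogram with horizontal top and bottom sides, the top side shifted half a unit to the right relative to the bottom side); a left-lozenge consists of an up-pointing unit triangle and the down-pointing unit triangle immediately to its left. For a bounded region $G$, give each right-lozenge the weight $q^k$, where $k\sqrt3/2$ is the distance between the bottom (horizontal) side of the lozenge and the highest horizontal lattice line meeting the closure of $G$; give weight $1$ to all vertical- and left-lozenges. The weight of a tiling is the product of the weights of its lozenges, and $M(G;q)$ is the sum of the weights of all lozenge tilings of $G$. $[n]=\{1,2,\dots,n\}$. For non-negative integers $a,b,c$ with $c\le a+b$, $V_{a,b,c}$ is the hexagon on the lattice with side lengths $a,b,c,a+b-c,c,b$ in clockwise order starting from the (horizontal) top side. Its horizontal diagonal $\ell$ joins its leftmost and rightmost vertices (at depth $b$ below the top side) and has length $a+b$; label the unit segments of $\ell$ from left to right by $1,\dots,a+b$. For $X,Y\subseteq[a+b]$, $V_{a,b,c}(X,Y)$ is obtained from $V_{a,b,c}$ by removing the up-pointing unit triangles whose bases are the unit segments of $\ell$ labeled by elements of $X$, and the down-pointing unit triangles whose (top) bases are the unit segments of $\ell$ labeled by elements of $Y$. For a positive integer $n$, $[n]_q=\frac{1-q^n}{1-q}$. For a finite set $S$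 of positive integers, $\Delta_{1,q}(S)=\prod_{s,s'\in S,\ s<s'}([s']_q-[s]_q)$ (empty product $=1$). *)

(* Defs.v *)
From mathcomp Require Import all_boot all_order all_algebra.
From mathcomp Require Import fraction finmap.

Set Implicit Arguments.
Unset Strict Implicit.
Unset Printing Implicit Defensive.

Import GRing.Theory.
Local Open Scope fset_scope.
Local Open Scope nat_scope.

(* A lattice point (r, j) lies on the horizontal lattice line at depth r, at
   abscissa j - r / 2.  Only the quadrant r, j >= 0 is represented, which is
   enough for every region below. *)
Definition point := (nat * nat)%type.

(* (up, r, j) is a unit triangle in the strip between the lines at depths r
   and r + 1; [vertices] fixes its position. *)
Definition triangle := (bool * nat * nat)%type.

Definition is_up (t : triangle) : bool := t.1.1.
Definition strip (t : triangle) : nat := t.1.2.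
Definition pos (t : triangle) : nat := t.2.

(* up-pointing: apex, then the two ends of the base;
   down-pointing: the two ends of the top side, then the bottom vertex *)
Definition vertices (t : triangle) : seq point :=
  let: (up, r, j) := t in
  if up then [:: (r, j); (r.+1, j); (r.+1, j.+1)]
  else [:: (r, j); (r, j.+1); (r.+1, j.+1)].

Definition region := {fset triangle}.

(* A lozenge is recorded as the pair of its up-pointing triangle u and its
   down-pointing triangle d. *)
Definition lozenge := (triangle * triangle)%type.

Definition vertical_lozenge (l : lozenge) : bool :=
  let: (u, d) := l in
  [&& is_up u, ~~ is_up d, strip d == (strip u).+1 & pos d == pos u].

Definition right_lozenge (l : lozenge) : bool :=
  let: (u, d) := l in
  [&& is_up u, ~~ is_up d, strip d == strip u & pos d == pos u].

Definition left_lozenge (l : lozenge) : bool :=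
  let: (u, d) := l in
  [&& is_up u, ~~ is_up d, strip d == strip u & (pos d).+1 == pos u].

Definition is_lozenge (l : lozenge) : bool :=
  [|| vertical_lozenge l, right_lozenge l | left_lozenge l].

Definition lozenges (G : region) : {fset lozenge} :=
  [fset l in G `*` G | is_lozenge l].

(* each unit triangle of G belongs to exactly one lozenge of T *)
Definition tiling (G : region) (T : {fset lozenge}) : bool :=
  (T `<=` lozenges G) &&
  all (fun t => #|` [fset l in T | (l.1 == t) || (l.2 == t)]| == 1) G.

(* Depth of the highest horizontal lattice line meeting the closure of G: the
   closure of a triangle in strip r meets the lines at depths r and r + 1 and
   no other.  The maximum is only the start value of the minimum. *)
Definition top_line (G : region) : nat :=
  \big[minn/(\max_(t <- G) strip t)]_(t <- G) strip t.

Definition ratfun := {fraction {poly rat}}.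
Definition q : ratfun := tofrac 'X%R.

(* the bottom side of a right-lozenge in strip r is at depth r + 1 *)
Definition lozenge_weight (G : region) (l : lozenge) : ratfun :=
  if right_lozenge l then (q ^+ ((strip l.1).+1 - top_line G))%R else 1%R.

Definition M (G : region) : ratfun :=
  (\sum_(T <- fpowerset (lozenges G) | tiling G T)
     \prod_(l <- T) lozenge_weight G l)%R.

(* The hexagon V_{a,b,c} with its top side on the line at depth 0, from (0, 0)
   to (0, a).  The next corners in clockwise order are (b, a + b),
   (b + c, a + b), (b + c, c), (b, 0). *)
Definition in_hexagon (a b c : nat) (p : point) : bool :=
  let: (r, j) := p in
  [&& r <= b + c, j <= a + b, j <= a + r & r <= j + b].

Definition hexagon (a b c : nat) : region :=
  [fset t in [seq (s, j) | s <- [seq (up, r) | up <- [:: true; false],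
                                              r <- iota 0 (b + c)],
                           j <- iota 0 (a + b)]
   | all (in_hexagon a b c) (vertices t)].

(* The i-th unit segment of the horizontal diagonal joins (b, i - 1) to
   (b, i). *)
Definition dented_hexagon (a b c : nat) (X Y : {fset nat}) : region :=
  [fset t in hexagon a b c |
     ~~ [&& is_up t, (strip t).+1 == b & (pos t).+1 \in X] &&
     ~~ [&& ~~ is_up t, strip t == b & (pos t).+1 \in Y]].

Definition initseg (n : nat) : {fset nat} := [fset i in iota 1 n].

Definition shuffling (X' Y' X Y : {fset nat}) : Prop :=
  X `|` Y = X' `|` Y' /\ X `&` Y = X' `&` Y'.

Definition qnum (n : nat) : ratfun := ((1 - q ^+ n) / (1 - q))%R.

Definition Delta (S : {fset nat}) : ratfun :=
  (\prod_(s <- S) \prod_(s' <- S | (s < s')%N) (qnum s' - qnum s))%R.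

(* Each numerator is even, so that the integer divisions by 2 are exact. *)
Definition exponent (a b c : int) (X Y : {fset nat}) : int :=
  (\sum_(i <- X) i%:Z - (b + c) * \sum_(j <- Y) j%:Z
   - (b * (b + 1) %/ 2)%Z
   + (a + b + 1) * (b + 1) * c
   - ((b + 1) * c * (c + 1) %/ 2)%Z
   + ((a + b + 1) * c * (c - 1) %/ 2)%Z)%R.

(* Main.v *)
Require Import Defs.
From mathcomp Require Import all_boot all_order all_algebra.
From mathcomp Require Import fraction finmap.
From mathcomp Require Import perm zify ring.

(* A tiling is determined by the set of vertical lozenges crossing the
   horizontal diagonal, which must occupy unit segments outside X and Y; so M is
   a sum over sets Z of segments of the product of the generating functions of
   two trapezoids with dents at X u Z (upper half) and Y u Z (lower half).

   In a trapezoid, the vertical lozenges entering a strip interlace with those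
   leaving it, and the number of right-lozenges in the strip is then forced.
   Hence the generating function of a trapezoid obeys the branching rule of
   Schur polynomials.  As the weights of the successive strips form a geometric
   progression alpha Q^r, it is a principal specialization: up to a power of
   alpha it equals the Vandermonde product of the Q^u over the dents u, divided
   by that of 1, Q, ..., Q^(k-1).  The lower trapezoid is the upper one rotated
   by 180 degrees, with Q = 1/q.

   So each summand is, up to a power of q, Delta(X u Z) Delta(Y u Z).  The cross
   factors between Z and X, Y depend only on the multiset union of X and Y, so a
   shuffling multiplies all summands by the same factor. *)

Set Implicit Arguments.
Unset Strict Implicit.
Unset Printing Implicit Defensive.

Import Order.TTheory GRing.Theory Num.Theory.
Local Open Scope fset_scope.
Local Open Scope ring_scope.

(** * Weighted tilings and expansion along a triangle *)

Definition covers (l : lozenge) (t : triangle) := (l.1 == t) || (l.2 == t).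

Lemma lozenge_up l : is_lozenge l -> is_up l.1.
Proof. by case: l => u d /or3P[] /and4P[]. Qed.

Lemma lozenge_down l : is_lozenge l -> ~~ is_up l.2.
Proof. by case: l => u d /or3P[] /and4P[]. Qed.

Lemma lozengeNsym t s : is_lozenge (t, s) -> is_lozenge (s, t) = false.
Proof. by move/lozenge_up => /= tu; apply/negP => /lozenge_down /=; rewrite tu. Qed.

Lemma in_lozenges G l :
  (l \in lozenges G) = [&& is_lozenge l, l.1 \in G & l.2 \in G].
Proof. by rewrite in_fset /= !inE andbC. Qed.

Lemma tilingP (G : region) (T : {fset lozenge}) :
  reflect [/\ forall l, l \in T -> l \in lozenges G,
              forall t, t \in G -> exists2 l, l \in T & covers l t
            & forall l l' t, l \in T -> l' \in T ->
                covers l t -> covers l' t -> l = l']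
          (tiling G T).
Proof.
apply: (iffP andP) => [[/fsubsetP TG /allP Tcov]|[TG cov uniqT]].
  split=> // [t /Tcov /cardfs1P[l /fsetP /(_ l)]|l l' t lT l'T lt l't].
    by rewrite !inE eqxx => /andP[]; exists l.
  have tG : t \in G.
    have := TG _ lT; rewrite in_lozenges => /and3P[_ l1 l2].
    by case/orP: lt => /eqP<-.
  have /cardfs1P[l0 /fsetP E] := Tcov _ tG.
  have := E l; have := E l'; rewrite !inE lT l'T /=.
  by move: lt l't; rewrite /covers => -> -> /esym/eqP-> /esym/eqP->.
split; first by apply/fsubsetP.
apply/allP => t /cov[l lT lt]; apply/cardfs1P; exists l.
apply/fsetP => l'; rewrite !inE /=; apply/andP/eqP => [[l'T l't]|->] //.
exact: uniqT l't lt.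
Qed.

Section WeightedTilings.
Variables (R : comNzRingType).
Implicit Types (w : lozenge -> R) (G : region) (t s : triangle).

(** Weight and ring are arbitrary: the cut below sets the weights of single lozenges to 0, and
    non-vanishing is transferred between polynomials, fractions and rational numbers. *)
Definition Mw w G : R :=
  \sum_(T <- fpowerset (lozenges G) | tiling G T) \prod_(l <- T) w l.

(** Orders two adjacent triangles into a lozenge, so that an expansion may start from a triangle of
    either orientation. *)
Definition joined t s : lozenge := if is_lozenge (t, s) then (t, s) else (s, t).

Definition adj t s := is_lozenge (t, s) || is_lozenge (s, t).

Definition pair_weight w t s : R := if adj t s then w (joined t s) else 0.

Lemma adjC t s : adj t s = adj s t. Proof. exact: orbC. Qed.

Lemma adj_irr t : adj t t = false.
Proof.
by apply/negP; rewrite /adj orbb => Lt; have := lozengeNsym Lt; rewrite Lt.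
Qed.

Lemma joinedC t s : adj t s -> joined t s = joined s t.
Proof.
by rewrite /adj /joined => /orP[] L; rewrite L (lozengeNsym L).
Qed.

Lemma pair_weightC w t s : pair_weight w t s = pair_weight w s t.
Proof. by rewrite /pair_weight adjC; case: ifP => // /joinedC->. Qed.

Lemma covers_joined t s x :
  covers (joined t s) x = (x == t) || (x == s).
Proof.
by rewrite /covers /joined; case: ifP => _ /=; rewrite !(eq_sym x) // orbC.
Qed.

Lemma joined_in t s G : (joined t s \in lozenges G) = [&& adj t s, t \in G & s \in G].
Proof.
rewrite in_lozenges /adj /joined; case: ifP => [->|_] //=.
by rewrite [(s \in G) && _]andbC.
Qed.

Lemma joined_cover l t : is_lozenge l -> covers l t -> exists2 s, adj t s & l = joined t s.
Proof.
case: l => u d L /orP[/eqP/=<-|/eqP/=<-].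
  by exists d; rewrite /adj /joined L.
by exists u; rewrite /adj /joined ?L ?orbT // lozengeNsym.
Qed.

Lemma Mw_ext w w' G :
  {in lozenges G, w =1 w'} -> Mw w G = Mw w' G.
Proof.
move=> ww'; rewrite /Mw big_seq_cond [RHS]big_seq_cond.
apply: eq_bigr => T /andP[]; rewrite fpowersetE => /fsubsetP TG _.
by rewrite big_seq [RHS]big_seq; apply: eq_bigr => l /TG; apply: ww'.
Qed.

Lemma lozenges0 : lozenges fset0 = fset0.
Proof. by apply/fsetP => l; rewrite in_lozenges !inE; apply: andbF. Qed.

Lemma Mw0 w : Mw w fset0 = 1.
Proof.
have T0 : tiling fset0 fset0 by apply/tilingP; split=> // l; rewrite inE.
by rewrite /Mw lozenges0 fpowerset0 big_mkcond big_seq_fset1 T0 big_seq_fset0.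
Qed.

Lemma tiling_fset1U l G T :
  l \in lozenges G -> l \notin T ->
  tiling G (l |` T) = tiling (G `\ l.1 `\ l.2) T.
Proof.
rewrite in_lozenges => /and3P[L l1 l2] lT.
apply/tilingP/tilingP => -[TG cov uniqT].
  have old l' t : l' \in T -> covers l' t -> ~~ covers l t.
    move=> l'T l't; apply/negP => lt; move: lT.
    by rewrite (uniqT l l' t) ?l'T // in_fset1U ?eqxx ?l'T ?orbT.
  split=> [l' l'T|t|l' l'' t l'T l''T].
  - have := TG l'; rewrite in_fset1U l'T orbT !in_lozenges !inE => /(_ isT).
    case/and3P=> -> -> -> /=.
    have /norP[] := old _ l'.1 l'T (introT orP (or_introl (eqxx _))).
    have /norP[] := old _ l'.2 l'T (introT orP (or_intror (eqxx _))).
    by rewrite ![_ == l'.1]eq_sym ![_ == l'.2]eq_sym => -> -> -> ->.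
  - rewrite !inE => /and3P[tl2 tl1] /cov[l'].
    rewrite in_fset1U => /orP[/eqP->|l'T l't]; last by exists l'.
    by rewrite /covers ![_ == t]eq_sym (negPf tl1) (negPf tl2).
  - by apply: uniqT; rewrite in_fset1U ?l'T ?l''T orbT.
have new l' t : l' \in T -> covers l' t -> ~~ covers l t.
  move=> /TG; rewrite in_lozenges !inE /covers => /and3P[_ /and3P[? ? _] /and3P[? ? _]].
  by case/orP=> /eqP <-; rewrite ![l.1 == _]eq_sym ![l.2 == _]eq_sym; apply/norP.
split=> [l'|t tG|l' l'' t].
- rewrite in_fset1U => /orP[/eqP->|/TG]; first by rewrite in_lozenges L l1.
  by rewrite !in_lozenges !inE => /and3P[-> /and3P[_ _ ->] /and3P[_ _ ->]].
- have [lt|] := boolP (covers l t); first by exists l; rewrite ?fset1U1.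
  rewrite /covers ![_ == t]eq_sym => /norP[t1 t2].
  have [|l' l'T l't] := cov t; first by rewrite !inE t1 t2.
  by exists l'; rewrite // in_fset1U l'T orbT.
rewrite !in_fset1U => /orP[/eqP->|l'T] /orP[/eqP->|l''T] //.
- by move=> lt /(new _ _ l''T); rewrite lt.
- by move=> /(new _ _ l'T)/negPf->.
- exact: uniqT.
Qed.

(** Adding [l] is a bijection from the tilings of the remaining region onto the tilings that contain
    [l]. *)
Lemma sum_tilings_with w G l :
  l \in lozenges G ->
  \sum_(T <- fpowerset (lozenges G) | tiling G T && (l \in T)) \prod_(x <- T) w x
  = w l * Mw w (G `\ l.1 `\ l.2).
Proof.
move=> lG; set G' := G `\ l.1 `\ l.2.
have G'G l' : l' \in lozenges G' -> l' \in lozenges G.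
  by rewrite !in_lozenges !inE => /and3P[-> /and3P[_ _ ->] /and3P[_ _ ->]].
have lG' : l \notin lozenges G' by rewrite in_lozenges !inE eqxx !andbF.
rewrite /Mw big_distrr /= -[LHS]big_filter.
rewrite (perm_big (map (fun T => l |` T) [seq T <- fpowerset (lozenges G') | tiling G' T])) /=.
  rewrite big_map big_filter big_seq_cond [RHS]big_seq_cond; apply: eq_bigr => T.
  rewrite fpowersetE => /andP[/fsubsetP TG' _].
  by rewrite big_fsetU1 //; apply: contra lG' => /TG'.
apply: uniq_perm; rewrite ?map_inj_in_uniq ?filter_uniq ?fset_uniq //.
  move=> T1 T2; rewrite !mem_filter !fpowersetE => /andP[_ /fsubsetP T1G].
  move=> /andP[_ /fsubsetP T2G] E.
  have N1 : l \notin T1 by apply: contra lG' => /T1G.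
  have N2 : l \notin T2 by apply: contra lG' => /T2G.
  by rewrite -(fsetU1K N1) -(fsetU1K N2) E.
move=> T; rewrite mem_filter fpowersetE; apply/idP/mapP.
  case/andP=> /andP[TT lT] TG; have TlT := fsetD1K lT.
  have N : l \notin T `\ l by rewrite !inE eqxx.
  exists (T `\ l); last by rewrite TlT.
  rewrite mem_filter fpowersetE -tiling_fset1U // TlT TT /=.
  by move: TT; rewrite -{1}TlT tiling_fset1U // => /andP[].
case=> T'; rewrite mem_filter fpowersetE => /andP[TT' /fsubsetP T'G'] ->.
have N : l \notin T' by apply: contra lG' => /T'G'.
rewrite tiling_fset1U // TT' fset1U1 /=; apply/fsubsetP => l'.
by rewrite in_fset1U => /orP[/eqP->|/T'G'/G'G].
Qed.

(** In each tiling [t] lies in exactly one lozenge, and [s] is the other triangle of that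
    lozenge. *)
Lemma peel w G t : t \in G ->
  Mw w G = \sum_(s <- G) pair_weight w t s * Mw w (G `\ t `\ s).
Proof.
move=> tG.
transitivity (\sum_(s <- G | adj t s)
  \sum_(T <- fpowerset (lozenges G) | tiling G T && (joined t s \in T))
     \prod_(l <- T) w l); last first.
  rewrite big_seq_cond [RHS]big_seq [RHS](bigID (adj t)) /= [X in _ + X]big1 ?addr0.
    apply: eq_bigr => s /andP[sG ts].
    rewrite sum_tilings_with ?joined_in ?ts ?tG //= /pair_weight ts; congr (_ * Mw w _).
    by rewrite /joined; case: ifP => _ //=; apply/fsetP => x; rewrite !inE andbCA.
  by move=> s /andP[_ /negPf ts]; rewrite /pair_weight ts mul0r.
(* After the exchange of sums, a fixed tiling must be counted by exactly one [s], the partner of [t]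
   in it. *)
under eq_bigr do rewrite big_mkcond.
rewrite exchange_big /= /Mw big_mkcond; apply: eq_bigr => T _.
have [TT|_] := boolP (tiling G T); last by rewrite big1.
have [TG cov uniqT] := tilingP _ _ TT.
have [l lT lt] := cov t tG.
have Ll := TG _ lT; have := Ll; rewrite in_lozenges => /andP[L _].
have [s ts ls] := joined_cover L lt.
have sG : s \in G by move: Ll; rewrite ls joined_in => /and3P[].
rewrite [RHS]big_mkcond (big_fsetD1 s) //= -ls lT ts /=.
rewrite [X in _ + X]big_seq [X in _ + X]big1 ?addr0 //.

move=> s'; rewrite !inE => /andP[s's s'G]; case: ifP => // ts'.
case: ifP => // l'T.
have E : joined t s' = l by apply: (uniqT _ _ t) => //; rewrite covers_joined eqxx.
have: covers l s' by rewrite -E covers_joined eqxx orbT.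
rewrite ls covers_joined (negPf s's) orbF => /eqP s't.
by rewrite s't adj_irr in ts'.
Qed.

End WeightedTilings.

(** * Cutting a region *)

Fixpoint subs (T : Type) (s : seq T) : seq (seq T) :=
  if s is x :: s' then [seq x :: r | r <- subs s'] ++ subs s' else [:: [::]].

Lemma subs_subseq (T : eqType) (s r : seq T) : r \in subs s -> subseq r s.
Proof.
elim: s r => [|x s IH] r /=; first by rewrite inE => /eqP->.
rewrite mem_cat => /orP[/mapP[r' r's ->]|/IH rs]; first by rewrite /= eqxx IH.
exact: subseq_trans rs (subseq_cons s x).
Qed.

Lemma nil_in_subs (T : eqType) (s : seq T) : [::] \in subs s.
Proof. by elim: s => //= x s IH; rewrite mem_cat IH orbT. Qed.

Lemma take_in_subs (T : eqType) (s : seq T) n : take n s \in subs s.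
Proof.
elim: s n => [|x s IH] [|n] //=; first by rewrite mem_cat nil_in_subs orbT.
by rewrite mem_cat map_f.
Qed.

Section Expansion.
Variables (R : comNzRingType).
Implicit Types (w : lozenge -> R) (G A B : region) (t s : triangle).

Lemma peel_zero w G t : t \in G ->
  (forall s, s \in G -> ~~ adj t s) -> Mw w G = 0.
Proof.
move=> tG tN; rewrite (peel w tG) big_seq big1 // => s /tN/negPf ts.
by rewrite /pair_weight ts mul0r.
Qed.

Lemma peel_one w G t s : t \in G -> s \in G -> adj t s ->
  (forall x, x \in G -> adj t x -> x = s) ->
  Mw w G = w (joined t s) * Mw w (G `\ t `\ s).
Proof.
move=> tG sG ts tN; rewrite (peel w tG) (big_fsetD1 s) //= /pair_weight ts.
rewrite big_seq big1 ?addr0 // => x; rewrite !inE => /andP[xs xG].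
case: ifP => [tx|]; last by rewrite mul0r.
by rewrite (tN x xG tx) eqxx in xs.
Qed.

Lemma peel_two w G t s1 s2 : t \in G -> s1 \in G -> s2 \in G -> s1 != s2 ->
  adj t s1 -> adj t s2 ->
  (forall x, x \in G -> adj t x -> x = s1 \/ x = s2) ->
  Mw w G = w (joined t s1) * Mw w (G `\ t `\ s1)
         + w (joined t s2) * Mw w (G `\ t `\ s2).
Proof.
move=> tG s1G s2G s12 ts1 ts2 tN; rewrite (peel w tG) (big_fsetD1 s1) //=.
rewrite (big_fsetD1 s2) /= ?inE ?s2G ?andbT 1?eq_sym // /pair_weight ts1 ts2; congr (_ + _).
rewrite big_seq big1 ?addr0 // => x; rewrite !inE => /and3P[xs2 xs1 xG].
case: ifP => [tx|]; last by rewrite mul0r.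
by case: (tN x xG tx) => E; rewrite E eqxx in xs1 xs2.
Qed.

Lemma fset_card_ind (P : region -> Prop) :
  (forall G, (forall G', G' `<` G -> P G') -> P G) -> forall G, P G.
Proof.
move=> H G; have [n] := ubnP #|` G|; elim: n G => // n IH G Gn.
by apply: H => G' /fproper_ltn_card G'G; apply: IH; apply: leq_trans G'G _.
Qed.

Lemma fsetD1_proper G t s : t \in G -> G `\ t `\ s `<` G.
Proof.
move=> tG; apply: fsub_proper_trans (fproperD1 tG).
by apply/fsubsetP => x; rewrite !inE => /andP[].
Qed.

(** By [peel] only the pair weights matter. Hence [f] may reverse the orientation of triangles, as a
    half-turn does. *)
Lemma Mw_imfset w w' (f : triangle -> triangle) G :
  {in G &, injective f} -> {in G &, forall t s, pair_weight w' (f t) (f s) = pair_weight w t s} ->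
  Mw w' (f @` G) = Mw w G.
Proof.
elim/fset_card_ind: G => G IH finj fK.
have [->|[t tG]] := fset_0Vmem G; first by rewrite imfset0 !Mw0.
have ftG : f t \in f @` G by apply: in_imfset.
rewrite (peel w tG) (peel w' ftG) big_imfset //=.
rewrite big_seq [RHS]big_seq; apply: eq_bigr => s sG; rewrite fK //.
congr (_ * _); have sub x : x \in G `\ t `\ s -> x \in G by rewrite !inE => /and3P[].
rewrite -IH; [congr (Mw w')|exact: fsetD1_proper| |].
- apply/fsetP => y; rewrite !inE; apply/idP/idP.
    case/and3P=> ys yt /imfsetP[x /= xG yx]; apply/imfsetP; exists x => //=.
    by rewrite !inE xG andbT; apply/andP; split;
       [apply: contra ys|apply: contra yt] => /eqP<-; rewrite yx.
  case/imfsetP=> x; rewrite /= !inE => /and3P[xs xt xG ->].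
  by rewrite in_imfset // andbT !(inj_in_eq finj) // xs xt.
- by move=> x y /sub xG /sub yG; apply: finj.
- by move=> x y /sub xG /sub yG; apply: fK.
Qed.

(** Tilings either contain [l] or survive when [l] gets weight 0. If both sides are peeled at [l.1],
    only the term of [l.2] differs. *)
Lemma Mw_edge w G l : l \in lozenges G ->
  Mw w G = w l * Mw w (G `\ l.1 `\ l.2) + Mw (fun x => if x == l then 0 else w x) G.
Proof.
set w0 := fun x => _; move=> lG; have := lG; rewrite in_lozenges => /and3P[L l1 l2].
have ll : joined l.1 l.2 = l by rewrite /joined -surjective_pairing L.
have a12 : adj l.1 l.2 by rewrite /adj -surjective_pairing L.
have l12 : l.2 \in G `\ l.1.
  by rewrite !inE l2 andbT; apply/eqP => E; move: a12; rewrite E adj_irr.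
rewrite (peel w l1) (peel w0 l1) (big_fsetD1 l.2) //= [X in _ = _ + X](big_fsetD1 l.2) //=.
rewrite /pair_weight a12 ll {1}/w0 eqxx mul0r add0r; congr (_ + _).
rewrite big_seq [RHS]big_seq; apply: eq_bigr => s; rewrite !inE => /andP[sl2 sG].
have no x : x \in lozenges (G `\ l.1 `\ s) -> w x = w0 x.
  rewrite /w0; case: eqP => // ->.
  by rewrite in_lozenges !inE eqxx /= !andbF.
rewrite (Mw_ext no); congr (_ * _); case: ifP => // l1s; rewrite /w0.
case: eqP => // E; have: covers l s by rewrite -E covers_joined eqxx orbT.
rewrite -ll covers_joined (negPf sl2) orbF => /eqP sl1.
by rewrite sl1 adj_irr in l1s.
Qed.

Lemma Mw_disjoint w A B : (forall a, a \in A -> a \notin B) ->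
  (forall a b, a \in A -> b \in B -> pair_weight w a b = 0) ->
  Mw w (A `|` B) = Mw w A * Mw w B.
Proof.
elim/fset_card_ind: A => A IH AB AB0.
have [->|[t tA]] := fset_0Vmem A; first by rewrite fset0U Mw0 mul1r.
have tAB : t \in A `|` B by rewrite inE tA.
rewrite (peel w tA) (peel w tAB) big_distrl /=.
rewrite (big_fsetID _ (mem A)) /= [X in _ + X]big_seq [X in _ + X]big1 => [|s].
  rewrite addr0 (_ : [fset x in A `|` B | x \in A] = A); last first.
    by apply/fsetP => x; rewrite !inE; case: (x \in A); rewrite ?andbF ?andbT.
  rewrite big_seq [RHS]big_seq; apply: eq_bigr => s sA.
  rewrite -mulrA -IH ?fsetD1_proper //.
  - congr (_ * Mw w _); apply/fsetP => x; rewrite !inE.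
    have [->|_] := eqVneq x s; first by rewrite (negPf (AB _ sA)).
    by have [->|_] := eqVneq x t; first by rewrite (negPf (AB _ tA)).
  - by move=> x; rewrite !inE => /and3P[_ _ /AB].
  - by move=> x b; rewrite !inE => /and3P[_ _ xA]; apply: AB0.
rewrite !inE /= => /andP[/orP[sA|sB]]; first by rewrite sA.
by rewrite AB0 // mul0r.
Qed.

(** The crossing lozenges are decided one at a time by [Mw_edge]: either the first one is used and
    its triangles leave [A] and [B], or its weight becomes 0 and it no longer crosses. When [J] is
    exhausted, [Mw_disjoint] applies. *)
Lemma Mw_cut (up dn : nat -> triangle) w A B (J : seq nat) :
  injective up -> injective dn -> uniq J ->
  (forall a, a \in A -> a \notin B) ->
  (forall j, j \in J -> [/\ up j \in A, dn j \in B,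
     is_lozenge (up j, dn j) & w (up j, dn j) = 1]) ->
  (forall a b, a \in A -> b \in B -> pair_weight w a b != 0 ->
     exists2 j, j \in J & a = up j /\ b = dn j) ->
  Mw w (A `|` B) = \sum_(S <- subs J) Mw w (A `\` [fset up j | j in S]) *
                                      Mw w (B `\` [fset dn j | j in S]).
Proof.
move=> upI dnI; elim: J w A B => [|j J IH] w A B /=.
  move=> _ AB _ cross; rewrite big_seq1.
  rewrite (_ : [fset up j | j in [::]] = fset0); last first.
    by apply/fsetP=> x; rewrite inE; apply/imfsetP => -[].
  rewrite (_ : [fset dn j | j in [::]] = fset0); last first.
    by apply/fsetP=> x; rewrite inE; apply/imfsetP => -[].
  rewrite !fsetD0 Mw_disjoint // => a b aA bB.
  by apply/eqP/negPn/negP => /(cross a b aA bB)[].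
case/andP=> jJ uJ AB inJ cross.
have [ujA djB Lj wj] := inJ j (mem_head _ _).
have jG : (up j, dn j) \in lozenges (A `|` B).
  by rewrite in_lozenges Lj !inE ujA djB orbT.
have neq i : i \in J -> i != j by move=> iJ; apply: contraNneq jJ => <-.
rewrite (Mw_edge w jG) wj mul1r big_cat big_map /=; congr (_ + _).
  transitivity (Mw w ((A `\ up j) `|` (B `\ dn j))).
    congr (Mw w _); apply/fsetP => x; rewrite !inE.
    have [->|_] := eqVneq x (dn j).
      by rewrite /= orbF; apply/esym/negP => /andP[_ /AB]; rewrite djB.
    by have [->|_] := eqVneq x (up j); first by rewrite /= (negPf (AB _ ujA)).
  rewrite IH //.
  - apply: eq_bigr => S _; congr (Mw w _ * Mw w _); apply/fsetP => x; rewrite !inE.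
      rewrite andbA -negb_or orbC; congr (~~ _ && _); apply/orP/imfsetP => /=.
        by case=> [/eqP->|/imfsetP[i /= iS ->]]; [exists j|exists i];
          rewrite // inE ?eqxx ?iS ?orbT.
      case=> i; rewrite inE => /orP[/eqP->->|iS ->]; first by left.
      by right; apply/imfsetP; exists i.
    rewrite andbA -negb_or orbC; congr (~~ _ && _); apply/orP/imfsetP => /=.
      by case=> [/eqP->|/imfsetP[i /= iS ->]]; [exists j|exists i];
        rewrite // inE ?eqxx ?iS ?orbT.
    case=> i; rewrite inE => /orP[/eqP->->|iS ->]; first by left.
    by right; apply/imfsetP; exists i.
  - by move=> a; rewrite !inE negb_and => /andP[_ /AB->]; rewrite orbT.
  - move=> i iJ; have [|uA dB L wi] := inJ i; first by rewrite inE iJ orbT.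
    by rewrite !inE uA dB !andbT (inj_eq upI) (inj_eq dnI) neq.
  - move=> a b; rewrite !inE => /andP[auj aA] /andP[bdj bB].
    case/(cross a b aA bB) => i; rewrite inE => /orP[/eqP->|iJ]; last by exists i.
    by case=> E; rewrite E eqxx in auj.
(* In the second summand the lozenge at [j] has weight 0. After the cut this change is invisible, as
   neither part contains both of its triangles. *)
set w0 := fun x => _.
have w0A G : (~~ ((up j \in G) && (dn j \in G))) -> Mw w0 G = Mw w G.
  move=> jNG; apply: Mw_ext => x; rewrite /w0; case: eqP => // ->.
  by rewrite in_lozenges /= (negPf jNG) andbF.
rewrite IH //.
- have djA : dn j \in A = false by apply/negP => /AB; rewrite djB.
  by apply: eq_bigr => S _; rewrite !w0A // !inE ?djA ?(negPf (AB _ ujA)) ?andbF.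
- move=> i iJ; have [|uA dB L wi] := inJ i; first by rewrite inE iJ orbT.
  split=> //; rewrite /w0; case: eqP => // -[/upI ij].
  by have := neq i iJ; rewrite ij eqxx.
- move=> a b aA bB pab.
  have ab : adj a b by apply: contraNT pab; rewrite /pair_weight => /negPf->.
  have Kw : pair_weight w a b != 0.
    by apply: contraNneq pab; rewrite /pair_weight ab /w0 => ->; case: ifP.
  have [i] := cross a b aA bB Kw.
  rewrite inE => /orP[/eqP->[au bd]|iJ ?]; last by exists i.
  by move: pab; rewrite /pair_weight ab /w0 au bd /joined Lj eqxx eqxx.
Qed.

End Expansion.

(** * Nested sums over gaps and the Vandermonde determinant *)

Section GapSums.
Variable R : comNzRingType.
Implicit Types (v Q alpha : R) (F : seq nat -> R) (us ds : seq nat).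

(** Sum over the sequences interlacing with [p :: us]. In a strip, [d] is the vertical lozenge
    before the dent [u], and [u.-1 - d] counts the right-lozenges forced between the two. *)
Fixpoint gapsum v (p : nat) us F : R :=
  if us is u :: us' then
    \sum_(p <= d < u) v ^+ (u.-1 - d) * gapsum v u us' (fun ds => F (d :: ds))
  else F [::].

Fixpoint in_gaps (p : nat) us ds : bool :=
  match us, ds with
  | u :: us', d :: ds' => (p <= d < u)%N && in_gaps u us' ds'
  | [::], [::] => true
  | _, _ => false
  end.

Lemma in_gapsP p us ds : path ltn p us -> in_gaps p us ds ->
  [/\ size ds = size us, sorted ltn ds, all (leq p) ds
    & all (fun d => d < last p us)%N ds].
Proof.
elim: us p ds => [|u us IH] p [|d ds] //= /andP[pu usP] /andP[/andP[pd du] D].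
have [-> sds uds dsl] := IH _ _ usP D.
have ul : (u <= last u us)%N.
  by case/lastP: us usP {IH D dsl} => // s x; rewrite (path_sortedE ltn_trans) last_rcons
    all_rcons => /andP[/andP[/ltnW]].
split=> //.
- rewrite (path_sortedE ltn_trans) sds andbT; apply/allP => x /(allP uds).
  exact: leq_trans.
- by rewrite pd; apply/allP => x /(allP uds); apply: leq_trans; apply: ltnW.
- by rewrite dsl (leq_trans du).
Qed.

Lemma eq_gapsum v p us F F' :
  (forall ds, in_gaps p us ds -> F ds = F' ds) -> gapsum v p us F = gapsum v p us F'.
Proof.
elim: us p F F' => [|u us IH] p F F' E /=; first exact: E.
apply: eq_big_nat => d du; congr (_ * _); apply: IH => ds D.
by apply: E; rewrite /= du.
Qed.

Lemma gapsumZ v p us F c : gapsum v p us (fun ds => c * F ds) = c * gapsum v p us F.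
Proof.
elim: us p F => [|u us IH] p F //=; rewrite big_distrr /=.
by apply: eq_bigr => d _; rewrite IH mulrCA.
Qed.

Lemma gapsum_sum v p us (I : finType) (F : I -> seq nat -> R) :
  gapsum v p us (fun ds => \sum_i F i ds) = \sum_i gapsum v p us (F i).
Proof.
elim: us p F => [|u us IH] p F //=; rewrite exchange_big /=.
by apply: eq_bigr => d _; rewrite IH big_distrr.
Qed.

Lemma gapsum_prod v p us k (h : 'I_k -> nat -> R) : size us = k ->
  gapsum v p us (fun ds => \prod_(i < k) h i (nth 0%N ds i)) =
  \prod_(i < k) \sum_(nth 0%N (p :: us) i <= d < nth 0%N us i)
      v ^+ ((nth 0%N us i).-1 - d) * h i d.
Proof.
elim: us p k h => [|u us IH] p [|k] h //= usk; first by rewrite !big_ord0.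
case: usk => usk; rewrite big_ord_recl /= big_distrl /=; apply: eq_bigr => d _.
rewrite -mulrA; congr (_ * _).
under eq_gapsum do rewrite big_ord_recl /=.
by rewrite gapsumZ (IH u k (fun i => h (lift ord0 i))).
Qed.

(** Row [i] involves only entry [i] of [ds], so by multilinearity each sum over a gap moves into its
    row. *)
Lemma gapsum_det v p us k (g : 'I_k -> nat -> R) : size us = k ->
  gapsum v p us (fun ds => \det (\matrix_(i < k, j < k) g j (nth 0%N ds i))) =
  \det (\matrix_(i < k, j < k) \sum_(nth 0%N (p :: us) i <= d < nth 0%N us i)
      v ^+ ((nth 0%N us i).-1 - d) * g j d).
Proof.
move=> usk; rewrite /determinant gapsum_sum; apply: eq_bigr => s _.
rewrite gapsumZ; congr (_ * _); under eq_gapsum do under eq_bigr do rewrite mxE.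
rewrite (gapsum_prod v p (fun i => g ((s : 'S_k) i))) //.
by apply: eq_bigr => i _; rewrite mxE.
Qed.

(** Homogeneity: in each gap, [d], [u.-1 - d] and one unit from [size us] add up to [u]. *)
Lemma gapsum_scale alpha v p us F :
  alpha ^+ size us * gapsum (alpha * v) p us (fun ds => alpha ^+ sumn ds * F ds)
  = alpha ^+ sumn us * gapsum v p us F.
Proof.
elim: us p F => [|u us IH] p F /=; first by rewrite !mul1r.
rewrite !big_distrr /=; apply: eq_big_nat => d /andP[_ du].
under eq_gapsum do rewrite exprD -mulrA.
rewrite gapsumZ exprMn exprS exprD.
have -> : alpha ^+ u = alpha * alpha ^+ (u.-1 - d) * alpha ^+ d.
  by rewrite -exprS -exprD; congr (_ ^+ _); lia.
transitivity (alpha * alpha ^+ (u.-1 - d) * alpha ^+ d * v ^+ (u.-1 - d) *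
   (alpha ^+ size us * gapsum (alpha * v) u us (fun ds => alpha ^+ sumn ds * F (d :: ds)))).
  by ring.
by rewrite IH; ring.
Qed.

Definition vdm Q k us : R := \det (\matrix_(i < k, j < k) Q ^+ (nth 0%N us i * j)).

Lemma geometric_gap (A B : R) p u : (p <= u)%N ->
  (A - B) * \sum_(p <= d < u) A ^+ (u.-1 - d) * B ^+ d = A ^+ (u - p) * B ^+ p - B ^+ u.
Proof.
elim: u => [|u IH]; first by rewrite leqn0 => /eqP->; rewrite big_geq // mulr0 mul1r subrr.
rewrite leq_eqVlt ltnS => /orP[/eqP->|pu].
  by rewrite big_geq // mulr0 subnn mul1r subrr.
rewrite big_nat_recr //= subnn mul1r mulrDr.
transitivity (A * (A ^+ (u - p) * B ^+ p - B ^+ u) + (A - B) * B ^+ u).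
  rewrite -IH // [in RHS]mulrCA; congr (_ * _ + _); rewrite big_distrr /=.
  apply: eq_big_nat => d /andP[_ du]; rewrite mulrA -exprS; congr (A ^+ _ * _); lia.
by rewrite subSn // !exprS; ring.
Qed.

(* Replacing row [i + 1] by itself minus [Q ^+ (k * (u_(i+1) - u_i))] times row
   [i] kills the last column below its first entry; what remains is a matrix of
   telescoped geometric sums. *)
Lemma vdm_gapsum Q k u us : size us = k -> path ltn u us ->
  vdm Q k.+1 (u :: us) =
  Q ^+ (k * u) * (\prod_(j < k) (Q ^+ k - Q ^+ j)) * gapsum (Q ^+ k) u us (vdm Q k).
Proof.
move=> usk usP; set x := u :: us.
have x_mono i : (i < k)%N -> (nth 0%N x i <= nth 0%N x i.+1)%N.
  by move=> ik; apply: ltnW; move/pathP: usP => /(_ 0%N); apply; rewrite usk.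
pose M := \matrix_(i < k.+1, j < k.+1) Q ^+ (nth 0%N x i * j).
pose c i := Q ^+ (k * (nth 0%N x i - nth 0%N x i.-1)).
pose L := \matrix_(i < k.+1, j < k.+1) ((i == j)%:R - (i == j.+1 :> nat)%:R * c i).
have detL : \det L = 1.
  rewrite det_trig; last first.
    apply/is_trig_mxP => i j ij; rewrite mxE.
    have -> : (i == j) = false by apply/eqP => E; rewrite E ltnn in ij.
    have -> : (i == j.+1 :> nat) = false by apply/eqP => E; rewrite E ltnNge leqW in ij.
    by rewrite mul0r subr0.
  by rewrite big1 // => i _; rewrite mxE eqxx (ltn_eqF (leqnn _)) mul0r subr0.
have LM0 j : (L *m M) ord0 j = M ord0 j.
  rewrite mxE (bigD1 ord0) //= big1 => [|i i0]; first by rewrite !mxE /= mul0r subr0 mul1r addr0.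
  by rewrite [L _ _]mxE /= eq_sym (negPf i0) mul0r subr0 mul0r.
have LMS (i : 'I_k) j : (L *m M) (lift ord0 i) j =
    Q ^+ (nth 0%N x i.+1 * j) - c i.+1 * Q ^+ (nth 0%N x i * j).
  rewrite mxE (bigD1 (lift ord0 i)) //= (bigD1 (widen_ord (leqnSn k) i)) /=; last first.
    by rewrite -val_eqE /= /bump /= add1n ltn_eqF.
  rewrite big1 => [|l /andP[l1 l2]].
    rewrite addr0 !mxE /= eqxx /bump /= !add1n eqxx (ltn_eqF (leqnn _)) mul0r subr0 mul1r.
    by rewrite -val_eqE /= /bump /= add1n gtn_eqF // mul1r sub0r mulNr.
  rewrite [L _ _]mxE eq_sym (negPf l1) /= /bump /= add1n eqSS.
  rewrite (_ : (i == l :> nat) = false) ?mul0r ?subr0 ?mul0r //.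
  by apply: contraNF l2 => /eqP E; apply/eqP/val_inj.
have -> : vdm Q k.+1 x = \det (L *m M) by rewrite det_mulmx detL mul1r.
rewrite (expand_det_col _ ord_max) big_ord_recl big1 => [|i _]; last first.
  rewrite LMS /c [i.+1.-1]/= [val ord_max]/= -exprD !(mulnC _ k) -mulnDr.
  by rewrite subnK ?x_mono // subrr mul0r.
rewrite LM0 addr0 mxE /= mulnC -mulrA; congr (_ * _).
rewrite /cofactor add0n.
rewrite (gapsum_det _ _ (fun (j : 'I_k) d => Q ^+ (d * j)) usk : gapsum _ _ _ (vdm Q k) = _).
pose D := diag_mx (\row_(j < k) (Q ^+ k - Q ^+ j)).
have <- : \det D = \prod_(j < k) (Q ^+ k - Q ^+ j).
  by rewrite det_diag; apply: eq_bigr => j _; rewrite mxE.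
rewrite [RHS]mulrC -det_mulmx.
set A := _ *m D.
(* The sign from these [k] negated rows cancels the cofactor sign of the top right corner. *)
have -> : row' ord0 (col' ord_max (L *m M)) = -1 *: A.
  apply/matrixP => i j; rewrite [LHS]mxE [LHS]mxE LMS /A mul_mx_diag !mxE.
  rewrite lift_max [X in -1 * X]mulrC.
  under eq_bigr do rewrite mulnC exprM.
  rewrite geometric_gap; last exact: x_mono.
  by rewrite /c -!exprM !(mulnC _ j) mulN1r opprB.
by rewrite detZ mulrA -exprMn mulrNN mulr1 expr1n mul1r.
Qed.

End GapSums.

(** * Trapezoids with dents *)

Definition box (h w : nat) : seq triangle :=
  [seq (s, j) | s <- [seq (up, r) | up <- [:: true; false], r <- iota 0 h], j <- iota 0 w].

Lemma mem_box h w (up : bool) r j : ((up, r, j) \in box h w) = (r < h)%N && (j < w)%N.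
Proof.
apply/idP/andP.
  case/allpairsP=> p [/allpairsP [y [_ yh E]] pw [E1 E2]].
  have [_ ->] : (up, r) = (y.1, y.2) by rewrite -E -E1.
  by move: yh pw; rewrite E2 !mem_iota.
case=> rh jw; apply/allpairsP; exists ((up, r), j); split; rewrite ?mem_iota //.
by apply/allpairsP; exists (up, r); split; rewrite ?mem_iota //=; case: up.
Qed.

(* [k] strips below a top side of length [a], with dents [D] along the bottom. *)
Definition trap (a k : nat) (D : seq nat) : region :=
  [fset t in box k (a + k) | let: (up, r, j) := t in
    if up then (j <= a + r) && ~~ ((r.+1 == k) && (j \in D)) else (j < a + r)]%N.

Lemma in_trap a k D up r j : ((up, r, j) \in trap a k D) = (r < k)%N &&
  (if up then (j <= a + r) && ~~ ((r.+1 == k) && (j \in D)) else (j < a + r))%N.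
Proof. by rewrite in_fset /= inE mem_box; case: up; case: (j \in D); lia. Qed.

Definition row (a k : nat) (E : bool -> nat -> bool) : region :=
  [fset t in box k.+1 (a + k).+1 | let: (up, r, j) := t in (r == k) && E up j].

Lemma in_row a k E up r j :
  ((up, r, j) \in row a k E) = [&& r == k, (j <= a + k)%N & E up j].
Proof. by rewrite in_fset inE mem_box; case: (E up j); lia. Qed.

Lemma adj_down r j x : adj (false, r, j) x ->
  [\/ x = (true, r, j), x = (true, r, j.+1) | (0 < r)%N /\ x = (true, r.-1, j)].
Proof.
case: x => [[up s] i]; rewrite /adj /is_lozenge /vertical_lozenge /right_lozenge.
rewrite /left_lozenge /is_up /strip /pos /=.
by case: up => //=; move/or3P=> [] /andP[/eqP E1 /eqP E2]; subst; eauto using or3.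
Qed.

Lemma adj_up r j x : adj (true, r, j) x ->
  [\/ x = (false, r, j), (0 < j)%N /\ x = (false, r, j.-1) | x = (false, r.+1, j)].
Proof.
case: x => [[up s] i]; rewrite /adj /is_lozenge /vertical_lozenge /right_lozenge.
rewrite /left_lozenge /is_up /strip /pos /=.
by case: up => //=; rewrite orbF; move/or3P=> [] /andP[/eqP E1 /eqP E2]; subst; eauto using or3.
Qed.

Lemma lozengeE u s i d r j : is_lozenge ((u, s, i), (d, r, j)) =
  [&& u, ~~ d & [|| (r == s.+1) && (j == i), (r == s) && (j == i) | (r == s) && (j.+1 == i)]].
Proof.
rewrite /is_lozenge /vertical_lozenge /right_lozenge /left_lozenge /is_up /strip /pos /=.
by case: u; case: d.
Qed.

Lemma right_lozengeE u s i d r j : right_lozenge ((u, s, i), (d, r, j)) =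
  [&& u, ~~ d, r == s & j == i].
Proof. by []. Qed.

Lemma adj_right r j : adj (true, r, j) (false, r, j).
Proof. by rewrite /adj lozengeE; lia. Qed.

Lemma adj_left r j : adj (false, r, j) (true, r, j.+1).
Proof. by rewrite /adj !lozengeE; lia. Qed.

Lemma adj_vertical r j : (0 < r)%N -> adj (false, r, j) (true, r.-1, j).
Proof. by rewrite /adj !lozengeE; lia. Qed.

Section Trapezoid.
Variables (R : comNzRingType) (v : nat -> R) (a : nat).
Implicit Types (k p : nat) (us D : seq nat).

Definition wt (l : lozenge) : R := if right_lozenge l then v (strip l.1) else 1.

Lemma wt_right r j : wt (joined (true, r, j) (false, r, j)) = v r.
Proof.
have -> : joined (true, r, j) (false, r, j) = ((true, r, j), (false, r, j)).
  by rewrite /joined lozengeE !eqxx orbT.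
by rewrite /wt right_lozengeE !eqxx.
Qed.

Lemma wt_left r j : wt (joined (false, r, j) (true, r, j.+1)) = 1.
Proof.
have -> : joined (false, r, j) (true, r, j.+1) = ((true, r, j.+1), (false, r, j)).
  by rewrite /joined lozengeE.
by rewrite /wt right_lozengeE (ltn_eqF (ltnSn j)) andbF.
Qed.

Lemma wt_vertical r j : (0 < r)%N -> wt (joined (false, r, j) (true, r.-1, j)) = 1.
Proof.
move=> r0.
have -> : joined (false, r, j) (true, r.-1, j) = ((true, r.-1, j), (false, r, j)).
  by rewrite /joined lozengeE.
by rewrite /wt right_lozengeE gtn_eqF ?prednK.
Qed.

(* [before b k p us D] is what remains of the trapezoid with [k + 1] strips
   when its bottom strip has been covered from the left up to the up-pointing
   ([b = false]) or down-pointing ([b = true]) triangle at position [p]: [us]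
   are the dents of the bottom strip, and [D] the up-pointing triangles of the
   strip above used by vertical lozenges. *)
Definition before (b : bool) k p us D : region := trap a k D `|`
  row a k (fun up j => if up then (p + b <= j) && (j \notin us) else p <= j < a + k)%N.

Lemma in_before b k p us D up r j : ((up, r, j) \in before b k p us D) =
  (r < k)%N && (if up then (j <= a + r) && ~~ ((r.+1 == k) && (j \in D)) else (j < a + r))%N
  || [&& r == k, (j <= a + k)%N &
      if up then (p + b <= j) && (j \notin us) else p <= j < a + k]%N.
Proof. by rewrite in_fsetU in_trap in_row. Qed.

Definition in_regionE := (in_fsetD1, in_before, xpair_eqE).

Lemma before_up_removed k p us D : p \in us ->
  before false k p us D = before true k p us D.
Proof.
move=> pu; apply/fsetP => -[[up r] j]; rewrite 2!in_before.
case: up => //.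
by have [->|jp] := eqVneq j p; [rewrite pu; lia | case: (j \in us); lia].
Qed.

Lemma before_down_consr k p us D : before true k p (p :: us) D = before true k p us D.
Proof.
apply/fsetP => -[[up r] j]; rewrite 2!in_before inE; case: up => //.
by have [->|jp] := eqVneq j p; [lia | case: (j \in us); lia].
Qed.

Lemma before_up_end k us D p : p = (a + k)%N -> p \notin us ->
  Mw wt (before false k p us D) = 0.
Proof.
move=> pE pu; apply: (@peel_zero _ _ _ (true, k, p)).
  by rewrite !in_regionE pu; lia.
move=> s sG; apply: contraL sG => /adj_up[->|[p0 ->]|->]; rewrite !in_regionE; lia.
Qed.

(** The down-pointing triangle on the left is already covered and no strip lies below, which leaves
    only the right-lozenge. *)
Lemma before_up_step k us D p : (p < a + k)%N -> p \notin us ->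
  Mw wt (before false k p us D) = v k * Mw wt (before false k p.+1 us D).
Proof.
move=> pE pu; rewrite (@peel_one _ _ _ (true, k, p) (false, k, p)).
- rewrite wt_right; congr (_ * Mw _ _).
  apply/fsetP => -[[up r] j]; rewrite !in_regionE.
  by case: up; rewrite /= ?andbT ?andbF; case: (j \in us); case: (j \in D); lia.
- by rewrite !in_regionE pu; lia.
- by rewrite !in_regionE; lia.
- exact: adj_right.
- by move=> x xG /adj_up[->//|[p0 E]|E]; move: xG; rewrite E !in_regionE; lia.
Qed.

Lemma before_down_end k us D p : p = (a + k)%N -> before true k p us D = trap a k D.
Proof.
by move=> pE; apply/fsetP => -[[up r] j]; rewrite in_before in_trap; case: up;
  case: (j \in us); lia.
Qed.

Lemma before_down_step0 us p : (p < a)%N -> p.+1 \notin us ->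
  Mw wt (before true 0 p us [::]) = Mw wt (before true 0 p.+1 us [::]).
Proof.
move=> pE pu; rewrite (@peel_one _ _ _ (false, 0%N, p) (true, 0%N, p.+1)).
- rewrite wt_left mul1r; congr (Mw _ _); apply/fsetP => -[[up r] j]; rewrite !in_regionE.
  by case: up; rewrite /= ?andbT ?andbF; case: (j \in us); lia.
- by rewrite !in_regionE; lia.
- by rewrite !in_regionE pu; lia.
- exact: adj_left.
- by move=> x xG /adj_down[E|E//|[p0 E]]; move: xG; rewrite E !in_regionE; lia.
Qed.

Lemma before_down_blocked0 us p : (p < a)%N -> p.+1 \in us ->
  Mw wt (before true 0 p us [::]) = 0.
Proof.
move=> pE pu; apply: (@peel_zero _ _ _ (false, 0%N, p)); first by rewrite !in_regionE; lia.
by move=> s sG; apply: contraL sG => /adj_down[->|->|[p0 ->]]; rewrite !in_regionE ?pu; lia.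
Qed.

(** The dent at [p.+1] excludes the left-lozenge, and the up-pointing triangle at [p] is gone, so
    the vertical lozenge is forced. *)
Lemma before_down_forced k us D p : (0 < k)%N -> (p < a + k)%N -> p.+1 \in us ->
  p \notin D ->
  Mw wt (before true k p us D) = Mw wt (before false k p.+1 us (p :: D)).
Proof.
move=> k0 pE pu pD; rewrite (@peel_one _ _ _ (false, k, p) (true, k.-1, p)).
- rewrite wt_vertical // mul1r; congr (Mw _ _); apply/fsetP => -[[up r] j]; rewrite !in_regionE inE.
  by case: up; rewrite /= ?andbT ?andbF; case: (j \in us); case: (j \in D); lia.
- by rewrite !in_regionE; lia.
- by rewrite !in_regionE (negPf pD); lia.
- exact: adj_vertical.
- by move=> x xG /adj_down[E|E|[p0 E]//]; move: xG; rewrite E !in_regionE ?pu; lia.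
Qed.

Lemma before_down_step k us D p : (0 < k)%N -> (p < a + k)%N -> p.+1 \notin us ->
  p \notin D ->
  Mw wt (before true k p us D) =
  Mw wt (before true k p.+1 us D) + Mw wt (before false k p.+1 us (p :: D)).
Proof.
move=> k0 pE pu pD.
rewrite (@peel_two _ _ _ (false, k, p) (true, k, p.+1) (true, k.-1, p)).
- rewrite wt_left wt_vertical // !mul1r.
  congr (Mw _ _ + Mw _ _); apply/fsetP => -[[up r] j]; rewrite !in_regionE ?inE;
  by case: up; rewrite /= ?andbT ?andbF; case: (j \in us); case: (j \in D); lia.
- by rewrite !in_regionE; lia.
- by rewrite !in_regionE pu; lia.
- by rewrite !in_regionE (negPf pD); lia.
- by rewrite !xpair_eqE; lia.
- exact: adj_left.
- exact: adj_vertical.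
- by move=> x xG /adj_down[E|E|[p0 E]]; [move: xG; rewrite E !in_regionE; lia|left|right].
Qed.

End Trapezoid.

Lemma trap_eq_mem a k D D' : D =i D' -> trap a k D = trap a k D'.
Proof. by move=> DD'; apply/fsetP => -[[up r] j]; rewrite 2!in_trap DD'. Qed.

Lemma trapS a k us : trap a k.+1 us = before a false k 0 us [::].
Proof.
apply/fsetP => -[[up r] j]; rewrite in_trap in_before in_nil andbF.
by case: up; case: (j \in us); lia.
Qed.

Lemma trap0 a D : trap a 0 D = fset0.
Proof. by apply/fsetP => -[[up r] j]; rewrite in_trap inE. Qed.

Lemma path_ltn_lt u us x : path ltn u us -> x \in us -> (u < x)%N.
Proof. by rewrite (path_sortedE ltn_trans) => /andP[/allP H _] /H. Qed.

(** * The branching rule for trapezoids *)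

Section TrapezoidRecursion.
Variables (R : comNzRingType) (v : nat -> R) (a : nat).
Implicit Types (k p u : nat) (us D : seq nat).
Notation W := (Mw (wt v)).

Lemma before_up_run k us D p u : (p <= u <= a + k)%N ->
  (forall j, (p <= j < u)%N -> j \notin us) ->
  W (before a false k p us D) = v k ^+ (u - p) * W (before a false k u us D).
Proof.
move=> /andP[]; elim: u => [|u IH]; first by rewrite leqn0 => /eqP->; rewrite mul1r.
rewrite leq_eqVlt ltnS => /orP[/eqP->|pu] ua uN; first by rewrite subnn mul1r.
rewrite IH //; last 2 first.
- exact: ltnW.
- by move=> j /andP[pj ju]; apply: uN; rewrite pj ltnW.
have uus : u \notin us by apply: uN; rewrite pu leqnn.
by rewrite before_up_step // mulrA -exprSr subSn.
Qed.

(** Only a dent can stop a run of right-lozenges; without one the run ends at an up-pointing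
    triangle that has no partner. *)
Lemma before_up_none k D p : (p <= a + k)%N -> W (before a false k p [::] D) = 0.
Proof.
move=> pa; rewrite (@before_up_run _ _ _ _ (a + k)) ?pa ?leqnn //.
by rewrite before_up_end // mulr0.
Qed.

Lemma before_up_next k u us D p : path ltn u us -> (p <= u <= a + k)%N ->
  W (before a false k p (u :: us) D) = v k ^+ (u - p) * W (before a true k u us D).
Proof.
move=> usP /andP[pu ua]; rewrite (@before_up_run _ _ _ _ u) ?pu //.
  by rewrite before_up_removed ?mem_head // before_down_consr.
move=> j /andP[pj ju]; rewrite inE negb_or ltn_eqF //=.
by apply/negP => /(path_ltn_lt usP); rewrite ltnNge ltnW.
Qed.

Lemma all_gt_notin p D : all (fun d => d < p)%N D -> p \notin D.
Proof. by move/allP => DP; apply/negP => /DP; rewrite ltnn. Qed.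

Lemma all_gt_cons p D : all (fun d => d < p)%N D -> all (fun d => d < p.+1)%N (p :: D).
Proof. by move/allP => DP /=; rewrite leqnn; apply/allP => d /DP /ltnW. Qed.

(** Past the last dent a vertical lozenge would start a run of right-lozenges that nothing stops, so
    left-lozenges fill the strip. *)
Lemma before_down_last k D p : (0 < k)%N -> (p <= a + k)%N ->
  all (fun d => d < p)%N D -> W (before a true k p [::] D) = W (trap a k D).
Proof.
move=> k0; move Dn: (a + k - p)%N => n; elim: n p Dn => [|n IH] p Dn pa DP.
  by rewrite before_down_end //; lia.
have pa' : (p < a + k)%N by lia.
rewrite before_down_step ?all_gt_notin // before_up_none // addr0 IH //; first lia.
by have /andP[] := all_gt_cons DP.
Qed.

(** Interlacing: exactly one vertical lozenge lies before the next dent [u], preceded by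
    left-lozenges and followed by right-lozenges. *)
Lemma before_down_next k u us D p : (0 < k)%N -> path ltn u us -> (p < u <= a + k)%N ->
  all (fun d => d < p)%N D ->
  W (before a true k p (u :: us) D) =
  \sum_(p <= d < u) v k ^+ (u.-1 - d) * W (before a true k u us (d :: D)).
Proof.
move=> k0 usP; move Dn: (u - p)%N => n; elim: n p Dn => [|n IH] p Dn /andP[pu ua] DP.
  by lia.
have DP' := all_gt_notin DP.
have [Eu|pu1] := eqVneq p.+1 u.
  rewrite before_down_forced ?Eu ?mem_head //.
  by rewrite before_up_next ?leqnn // -Eu big_nat1 subnn /= subnn.
have pN : p.+1 \notin u :: us.
  rewrite inE negb_or pu1; apply/negP => /(path_ltn_lt usP); lia.
rewrite before_down_step ?pN // ?IH //; [|lia|lia|by have /andP[] := all_gt_cons DP|lia].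
rewrite before_up_next //; last lia.
rewrite [RHS]big_ltn // addrC; congr (_ ^+ _ * _ + _); lia.
Qed.

Lemma before_down_gapsum k us D p : (0 < k)%N -> path ltn p us ->
  (last p us <= a + k)%N -> all (fun d => d < p)%N D ->
  W (before a true k p us D) = gapsum (v k) p us (fun ds => W (trap a k (D ++ ds))).
Proof.
move=> k0; elim: us p D => [|u us IH] p D /=.
  by move=> _ pa DP; rewrite before_down_last // cats0.
move=> /andP[pu usP] ua DP.
have u_le : (u <= a + k)%N.
  apply: leq_trans ua; case/lastP: us usP {IH} => // s x usP.
  by rewrite last_rcons ltnW // (path_ltn_lt usP) // mem_rcons mem_head.
rewrite before_down_next ?pu ?u_le //; apply: eq_big_nat => d /andP[pd du].
congr (_ * _); rewrite IH //=; last first.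
  by rewrite du; apply/allP => x /(allP DP) xp; apply: ltn_trans pu.
apply: eq_gapsum => ds _; congr (Mw _ _); apply: trap_eq_mem => x.
by rewrite !(inE, mem_cat) orbCA.
Qed.

(** The top strip admits no vertical lozenge upwards, so a further dent would leave a down-pointing
    triangle uncovered. *)
Lemma before_down0 us p : path ltn p us -> (last p us <= a)%N ->
  W (before a true 0 p us [::]) = (us == [::])%:R.
Proof.
move=> usP; case: us usP => [_|u us] /=.
  move Dn: (a - p)%N => n; elim: n p Dn => [|n IH] p Dn pa.
    by rewrite before_down_end ?trap0 ?Mw0 //; lia.
  by rewrite before_down_step0 ?IH //; lia.
move=> /andP[pu usP] ua.
have u_le : (u <= a)%N.
  apply: leq_trans ua; case/lastP: us usP => // s x usP.
  by rewrite last_rcons ltnW // (path_ltn_lt usP) // mem_rcons mem_head.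
move Dn: (u - p)%N => n; elim: n p Dn pu => [|n IH] p Dn pu; first by lia.
have [Eu|pu1] := eqVneq p.+1 u; first by rewrite before_down_blocked0 -?Eu ?mem_head //; lia.
rewrite before_down_step0 ?IH //; try lia.
rewrite inE negb_or pu1; apply/negP => /(path_ltn_lt usP); lia.
Qed.

(** The factor in front comes from the right-lozenges to the left of the first dent; the vertical
    lozenges of the strip become the dents of the smaller trapezoid. *)
Lemma trap_gapsum k u us : (0 < k)%N -> path ltn u us -> (last u us <= a + k)%N ->
  W (trap a k.+1 (u :: us)) = v k ^+ u * gapsum (v k) u us (fun ds => W (trap a k ds)).
Proof.
move=> k0 usP ua; have u_le : (u <= a + k)%N.
  apply: leq_trans ua; case/lastP: us usP => // s x usP.
  by rewrite last_rcons ltnW // (path_ltn_lt usP) // mem_rcons mem_head.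
by rewrite trapS before_up_next // subn0 before_down_gapsum.
Qed.

Lemma trap1 u us : path ltn u us -> (last u us <= a)%N ->
  W (trap a 1 (u :: us)) = v 0 ^+ u * (us == [::])%:R.
Proof.
move=> usP ua; have u_le : (u <= a)%N.
  apply: leq_trans ua; case/lastP: us usP => // s x usP.
  by rewrite last_rcons ltnW // (path_ltn_lt usP) // mem_rcons mem_head.
by rewrite trapS before_up_next ?addn0 // subn0 before_down0.
Qed.

Lemma trap_nil k : W (trap a k.+1 [::]) = 0.
Proof. by rewrite trapS before_up_none. Qed.

(** Each strip passes on one vertical lozenge fewer than it has dents, so a wrong number of dents
    persists up to the top strip, where it is impossible. *)
Lemma trap_unbalanced k us : sorted ltn us -> all (fun u => u < a + k.+1)%N us ->
  size us != k.+1 -> W (trap a k.+1 us) = 0.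
Proof.
elim: k us => [|k IH] [|u us] usP; rewrite ?trap_nil //.
  move=> ua usN; rewrite trap1 ?usP //; last first.
    by have := allP ua (last u us) (mem_last _ _); rewrite addn1.
  by case: us usN {usP ua} => //= *; rewrite mulr0.
move=> ua usk; have /= la := allP ua (last u us) (mem_last _ _).
rewrite trap_gapsum //; last by rewrite addnS ltnS in la.
(* Zero is written as a product so that [gapsumZ] can pull out a factor. *)
rewrite (@eq_gapsum _ _ _ _ _ (fun _ => 0 * 0)).
  by rewrite gapsumZ !mul0r mulr0.
move=> ds /(in_gapsP usP)[sds dsP _ dsa]; rewrite mul0r IH // ?sds //.
apply/allP => d /(allP dsa) dl; apply: leq_trans dl _.
by rewrite addnS ltnS in la.
Qed.

End TrapezoidRecursion.

(** * Product formula for trapezoids with geometric weights *)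

Section TrapezoidFormula.
Variables (R : comNzRingType) (alpha Q : R) (a : nat).
Notation W := (Mw (wt (fun r => alpha * Q ^+ r))).

(** The denominator of the principal specialization, kept as a multiplier because [R] need not be a
    field; see [trap_norm_pairprod]. *)
Definition trap_norm k : R :=
  \prod_(i < k) (alpha ^+ i * \prod_(j < i) (Q ^+ i - Q ^+ j)).

(** Both sides obey the same recursion in [k], by [trap_gapsum] and [vdm_gapsum]; [gapsum_scale]
    accounts for the powers of [alpha]. *)
Lemma trap_formula k us : sorted ltn us -> all (fun u => u < a + k)%N us -> size us = k ->
  trap_norm k * W (trap a k us) = alpha ^+ sumn us * vdm Q k us.
Proof.
elim: k us => [[|//] _ _ _|k IH [//|u us] usP ua [usk]].
  by rewrite /trap_norm big_ord0 trap0 Mw0 /vdm det_mx00.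
have /= la := allP ua (last u us) (mem_last _ _).
rewrite addnS ltnS in la.
rewrite /trap_norm big_ord_recr /= -/(trap_norm k) vdm_gapsum //.
have -> : W (trap a k.+1 (u :: us)) = (alpha * Q ^+ k) ^+ u *
    gapsum (alpha * Q ^+ k) u us (fun ds => W (trap a k ds)).
  (* A single strip is outside the scope of [trap_gapsum] and is handled by [trap1]. *)
  case: k usk {IH ua} la => [|k] usk la; last exact: trap_gapsum.
  rewrite addn0 in la; rewrite trap1 // (size0nil usk); congr (_ * _).
  by move: (trap0 a [::]) => /= ->; rewrite Mw0.
set P := \prod_(j < k) _.
transitivity (P * (alpha * Q ^+ k) ^+ u * (alpha ^+ size us *
   gapsum (alpha * Q ^+ k) u us (fun ds => trap_norm k * W (trap a k ds)))).
  by rewrite gapsumZ usk; ring.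
rewrite (@eq_gapsum _ _ _ _ _ (fun ds => alpha ^+ sumn ds * vdm Q k ds)).
  by rewrite gapsum_scale exprMn exprD -exprM; ring.
move=> ds /(in_gapsP usP)[sds dsP _ dsa]; apply: IH; rewrite ?sds //.
by apply/allP => d /(allP dsa) dl; apply: leq_trans dl _.
Qed.

Lemma vdm_prod k us : sorted ltn us -> size us = k ->
  vdm Q k us = \prod_(x <- us) \prod_(y <- us | (x < y)%N) (Q ^+ y - Q ^+ x).
Proof.
move=> usP <-; rewrite /vdm.
transitivity (\det (Vandermonde (size us) (\row_(i < size us) Q ^+ nth 0%N us i))^T).
  by congr (\det _); apply/matrixP => i j; rewrite !mxE exprM.
rewrite det_tr det_Vandermonde (big_nth 0%N) big_mkord; apply: eq_bigr => i _.
rewrite (big_nth 0%N) big_mkord; apply: eq_big => [j|j _]; last by rewrite !mxE.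
by rewrite -(lt_sorted_ltn_nth 0%N usP) ?inE.
Qed.

(** Any order of the dents is allowed, since the crossing segments will be appended to [X] or
    [Y]. *)
Lemma trap_product k us : uniq us -> all (fun u => u < a + k)%N us -> size us = k ->
  trap_norm k * W (trap a k us) =
  alpha ^+ (\sum_(u <- us) u)%N *
  \prod_(x <- us) \prod_(y <- us | (x < y)%N) (Q ^+ y - Q ^+ x).
Proof.
move=> uus ua usk; pose s := sort leq us.
have sP : perm_eq s us by rewrite perm_sort.
rewrite (@trap_eq_mem _ _ _ s); last by move=> x; rewrite (perm_mem sP).
have ss : sorted ltn s.
  by rewrite ltn_sorted_uniq_leq sort_uniq uus sort_sorted //; exact: leq_total.
have sk : size s = k by rewrite (perm_size sP).
rewrite trap_formula //; last by rewrite (perm_all _ sP).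
rewrite vdm_prod // sumnE -!(perm_big _ sP) /=; congr (_ * _).
by apply: eq_bigr => x _; rewrite -(perm_big _ sP).
Qed.

(** Without strips the region is empty and has weight 1 whatever [us] is, whence [0 < k]. *)
Lemma trap_unbalanced_uniq k us : (0 < k)%N -> uniq us -> all (fun u => u < a + k)%N us ->
  size us != k -> W (trap a k us) = 0.
Proof.
case: k => // k _ uus ua usk; pose s := sort leq us.
have sP : perm_eq s us by rewrite perm_sort.
rewrite (@trap_eq_mem _ _ _ s); last by move=> x; rewrite (perm_mem sP).
apply: trap_unbalanced; rewrite ?(perm_all _ sP) ?(perm_size sP) //.
by rewrite ltn_sorted_uniq_leq sort_uniq uus sort_sorted //; exact: leq_total.
Qed.

End TrapezoidFormula.

(** * Products over pairs *)

Section PairProducts.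
Variable R : comNzRingType.
Implicit Types (f : nat -> nat -> R) (s : seq nat).

(** Pairs are ordered by value and not by position, so the product is invariant under permutations
    of [s]. *)
Definition pairprod f s : R := \prod_(x <- s) \prod_(y <- s | (x < y)%N) f x y.

Lemma pairprod_perm f s1 s2 : perm_eq s1 s2 -> pairprod f s1 = pairprod f s2.
Proof.
move=> s12; rewrite /pairprod (perm_big _ s12); apply: eq_bigr => x _.
exact: perm_big.
Qed.

Lemma eq_pairprod f f' s :
  (forall x y, x \in s -> y \in s -> (x < y)%N -> f x y = f' x y) ->
  pairprod f s = pairprod f' s.
Proof.
move=> E; rewrite /pairprod big_seq [RHS]big_seq; apply: eq_bigr => x xs.
rewrite big_seq_cond [RHS]big_seq_cond; apply: eq_bigr => y /andP[ys xy].
exact: E.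
Qed.

Lemma pairprod_rcons f s x : all (fun y => y < x)%N s ->
  pairprod f (rcons s x) = pairprod f s * \prod_(y <- s) f y x.
Proof.
move=> /allP sx; rewrite /pairprod big_rcons /= [X in _ * X]big_seq_cond.
rewrite [X in _ * X]big_pred0 => [|y]; last first.
  rewrite mem_rcons inE; have [->|yx] /= := eqVneq y x; first by rewrite ltnn.
  by apply/negP => /andP[/sx]; rewrite ltnNge => /negP + /ltnW.
rewrite mulr1 -big_split /= big_seq [RHS]big_seq; apply: eq_bigr => y /sx yx.
by rewrite big_rcons /= yx.
Qed.

Lemma pairprodM f f' s :
  pairprod (fun x y => f x y * f' x y) s = pairprod f s * pairprod f' s.
Proof. by rewrite /pairprod -big_split; apply: eq_bigr => x _; rewrite big_split. Qed.

Lemma pairprod_const c s : uniq s -> pairprod (fun _ _ => c) s = c ^+ 'C(size s, 2).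
Proof.
move=> us; rewrite -(perm_size (permEl (perm_sort leq s))).
rewrite -(pairprod_perm _ (permEl (perm_sort leq s))).
have: sorted ltn (sort leq s).
  by rewrite ltn_sorted_uniq_leq sort_uniq us sort_sorted //; exact: leq_total.
elim/last_ind: (sort leq s) => [|r x IH]; first by rewrite /pairprod big_nil.
rewrite (sorted_pairwise ltn_trans) pairwise_rcons -(sorted_pairwise ltn_trans).
case/andP=> rx /IH rE.
rewrite pairprod_rcons // rE size_rcons big_const_seq count_predT.
by rewrite iter_mulr_1 binS bin1 exprD.
Qed.

Lemma pairprodZ c f s : uniq s ->
  pairprod (fun x y => c * f x y) s = c ^+ 'C(size s, 2) * pairprod f s.
Proof. by move=> us; rewrite pairprodM pairprod_const. Qed.

Lemma pairprod_map f s (h : nat -> nat) :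
  {in s &, {mono h : x y / (x < y)%N}} ->
  pairprod f (map h s) = pairprod (fun x y => f (h x) (h y)) s.
Proof.
move=> hm; rewrite /pairprod big_map big_seq [RHS]big_seq; apply: eq_bigr => x xs.
rewrite big_map big_seq_cond [RHS]big_seq_cond; apply: eq_bigl => y.
by case ys: (y \in s) => //=; rewrite hm.
Qed.

Lemma pairprod_map_rev f s (h : nat -> nat) :
  {in s &, {mono h : x y /~ (x < y)%N}} ->
  pairprod f (map h s) = pairprod (fun x y => f (h y) (h x)) s.
Proof.
move=> hm; rewrite /pairprod big_map.
under eq_bigr do rewrite big_map.
rewrite (exchange_big_dep predT) //= big_seq [RHS]big_seq; apply: eq_bigr => x xs.
rewrite big_seq_cond [RHS]big_seq_cond; apply: eq_bigl => y.
by case ys: (y \in s) => //=; rewrite hm.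
Qed.

(** The mixed factors of a concatenation, written with one term per entry of [s1] so that they are
    multiplicative in [s1]; equal entries contribute 1. *)
Definition crossprod f s1 s2 : R := \prod_(x <- s1) \prod_(y <- s2)
  ((if (x < y)%N then f x y else 1) * (if (y < x)%N then f y x else 1)).

Lemma pairprod_cat f s1 s2 :
  pairprod f (s1 ++ s2) = pairprod f s1 * pairprod f s2 * crossprod f s1 s2.
Proof.
have -> : crossprod f s1 s2 =
    (\prod_(x <- s1) \prod_(y <- s2 | (x < y)%N) f x y) *
    \prod_(x <- s2) \prod_(y <- s1 | (x < y)%N) f x y.
  rewrite [X in _ * X](exchange_big_dep predT) //= -big_split.
  apply: eq_bigr => x _ /=; rewrite big_split /=.
  by congr (_ * _); rewrite -big_mkcond.
rewrite /pairprod big_cat /=.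
under eq_bigr do rewrite big_cat.
under [X in _ * X]eq_bigr do rewrite big_cat.
by rewrite !big_split /=; ring.
Qed.

Lemma crossprod_perm f s1 s2 s1' s2' s : perm_eq (s1 ++ s2) (s1' ++ s2') ->
  crossprod f s1 s * crossprod f s2 s = crossprod f s1' s * crossprod f s2' s.
Proof. by move=> ss; rewrite /crossprod -!big_cat; apply: perm_big. Qed.

(** The factors inside [s] occur on both sides, and the mixed ones agree by [crossprod_perm]. *)
Lemma pairprod_shuffle f s1 s2 s1' s2' s : perm_eq (s1 ++ s2) (s1' ++ s2') ->
  pairprod f (s1 ++ s) * pairprod f (s2 ++ s) * (pairprod f s1' * pairprod f s2') =
  pairprod f (s1' ++ s) * pairprod f (s2' ++ s) * (pairprod f s1 * pairprod f s2).
Proof.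
move=> /(crossprod_perm f s) E; rewrite !pairprod_cat.
transitivity (pairprod f s1 * pairprod f s2 * pairprod f s * pairprod f s *
  pairprod f s1' * pairprod f s2' * (crossprod f s1 s * crossprod f s2 s)); first by ring.
by rewrite E; ring.
Qed.

End PairProducts.

Lemma trap_norm_pairprod (R : comNzRingType) (alpha Q : R) k :
  trap_norm alpha Q k =
  alpha ^+ 'C(k, 2) * pairprod (fun x y => Q ^+ y - Q ^+ x) (iota 0 k).
Proof.
elim: k => [|k IH]; first by rewrite /trap_norm /pairprod big_ord0 big_nil mulr1.
have -> : iota 0 k.+1 = rcons (iota 0 k) k by rewrite -[k.+1]addn1 iotaD cats1.
rewrite pairprod_rcons; last by apply/allP => x; rewrite mem_iota.
have -> : \prod_(y <- iota 0 k) (Q ^+ k - Q ^+ y) = \prod_(j < k) (Q ^+ k - Q ^+ j).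
  by rewrite -(big_mkord predT (fun j => Q ^+ k - Q ^+ j)) /index_iota subn0.
by rewrite /trap_norm big_ord_recr -/(trap_norm alpha Q k) IH binS bin1 exprD /=; ring.
Qed.

(** * Trapezoid formulas in q-integers, for [q] nonzero and not a root of unity *)

Section ClosedForms.
Variables (F : fieldType) (q : F).
Hypotheses (q0 : q != 0) (q_inj : forall x y, (x < y)%N -> q ^+ y != q ^+ x).

Definition qint (n : nat) : F := (1 - q ^+ n) / (1 - q).

Notation Dq := (pairprod (fun x y => qint y - qint x)).
Notation Vq := (pairprod (fun x y => q ^+ y - q ^+ x)).

Lemma q_neq1 : q - 1 != 0.
Proof. by rewrite subr_eq0 -(expr0 q) -{1}(expr1 q) q_inj. Qed.

Lemma Vq_Dq s : uniq s -> Vq s = (q - 1) ^+ 'C(size s, 2) * Dq s.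
Proof.
move=> us; rewrite -pairprodZ //; apply: eq_pairprod => x y _ _ _.
by rewrite /qint; field; rewrite -oppr_eq0 opprB q_neq1.
Qed.

Lemma Dq_neq0 s : Dq s != 0.
Proof.
rewrite /pairprod prodf_seq_neq0; apply/allP => x _ /=.
rewrite prodf_seq_neq0; apply/allP => y _ /=; apply/implyP => xy.
rewrite /qint -mulrBl mulf_neq0 ?invr_eq0 //.
  have -> : 1 - q ^+ y - (1 - q ^+ x) = - (q ^+ y - q ^+ x) by ring.
  by rewrite oppr_eq0 subr_eq0 q_inj.
by rewrite -opprB oppr_eq0 q_neq1.
Qed.

Lemma Vq_succ s : uniq s -> Vq (map succn s) = q ^+ 'C(size s, 2) * Vq s.
Proof.
move=> us; rewrite pairprod_map // -pairprodZ //; apply: eq_pairprod => x y _ _ _.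
by rewrite !exprS mulrBr.
Qed.

Notation Vinv := (pairprod (fun x y => q^-1 ^+ y - q^-1 ^+ x)).

(** The reflection of [x] to [n - x] trades [q] for its inverse up to the factor [q ^+ n]; it
    reverses the order in each pair, whence the sign. *)
Lemma Vq_rev n s : uniq s -> all (fun x => x <= n)%N s ->
  Vq s = (- q ^+ n) ^+ 'C(size s, 2) * Vinv [seq (n - x)%N | x <- s].
Proof.
move=> us /allP sn; rewrite pairprod_map_rev => [|x y /sn xn /sn yn]; last lia.
rewrite -pairprodZ //; apply: eq_pairprod => x y /sn xn /sn yn _.
have E z : (z <= n)%N -> q ^+ n * q^-1 ^+ (n - z) = q ^+ z.
  by move=> zn; rewrite -{1}(subnKC zn) exprD exprVn mulfK // expf_neq0.
by rewrite mulNr -mulrN opprB mulrBr !E.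
Qed.

Lemma sum_map_sub n s : all (fun x => x <= n)%N s ->
  (\sum_(x <- [seq (n - y)%N | y <- s]) x + \sum_(x <- s) x = n * size s)%N.
Proof.
move=> /allP sn; rewrite big_map -big_split /= big_seq.
rewrite (eq_bigr (fun=> n)) => [|x /sn]; last exact: subnK.
by rewrite -big_seq big_const_seq count_predT iter_addn_0.
Qed.

(* [s] lists the dents by their labels, which start at 1. *)
Lemma trap_upper a k s : uniq s -> all (fun x => 0 < x <= a + k)%N s -> size s = k ->
  Mw (wt (fun r => q * q ^+ r)) (trap a k (map predn s)) * Dq (iota 1 k) =
  q ^ ((\sum_(x <- s) x)%N%:Z - 'C(k.+1, 2)%:Z) * Dq s.
Proof.
move=> us sP sk; set W := Mw _ _; have ups : uniq (map predn s).
  rewrite map_inj_in_uniq // => x y /(allP sP) xP /(allP sP) yP; lia.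
have psK : map succn (map predn s) = s.
  rewrite -map_comp map_id_in // => x /(allP sP) /andP[x0 _]; exact: prednK.
have spk : size (map predn s) = k by rewrite size_map.
have sumE : (\sum_(x <- map predn s) x + k = \sum_(x <- s) x)%N.
  rewrite -[in RHS]psK [RHS]big_map -spk -sum1_size -big_split /=.
  by apply: eq_bigr => x _; rewrite addn1.
have normE : trap_norm q q k = (q - 1) ^+ 'C(k, 2) * Dq (iota 1 k).
  rewrite trap_norm_pairprod; have := Vq_succ (iota_uniq 0 k); rewrite size_iota => <-.
  have <- : iota 1 k = map succn (iota 0 k) by rewrite -(iotaDl 1 0).
  by rewrite Vq_Dq ?iota_uniq // size_iota.
have upa : all (fun u => u < a + k)%N (map predn s).
  by apply/allP => x /mapP[y /(allP sP) yP ->]; lia.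
have := @trap_product F q q a k _ ups upa spk; rewrite -/W normE.
have : Vq s = q ^+ 'C(k, 2) * Vq (map predn s) by rewrite -{1}psK Vq_succ // spk.
rewrite Vq_Dq // sk => E H.
apply: (mulfI (expf_neq0 'C(k, 2) q_neq1)).
apply: (mulfI (expf_neq0 'C(k, 2) q0)).
transitivity (q ^+ 'C(k, 2) * ((q - 1) ^+ 'C(k, 2) * Dq (iota 1 k) * W)); first by ring.
rewrite H mulrCA -E mulrCA [RHS]mulrCA; congr (_ * _); rewrite mulrA; congr (_ * _).
by rewrite !exprnP -expfzDr // binS bin1 -sumE !PoszD; congr (q ^ _); ring.
Qed.

(** This is [trap_product] with [alpha = q ^+ N] and [Q = q^-1], for the rotated lower trapezoid.
    [Vq_rev] returns both Vandermonde products to [q], with signs that cancel. *)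
Lemma trap_lower n N k s : (k <= n)%N -> uniq s -> all (fun x => 0 < x <= n)%N s ->
  size s = k ->
  Mw (wt (fun r => q ^+ N * q^-1 ^+ r)) (trap (n - k) k [seq (n - x)%N | x <- s])
    * Dq (iota 1 k) =
  q ^ (N%:Z * (n%:Z * k%:Z - (\sum_(x <- s) x)%N%:Z - 'C(k, 2)%:Z)
       - (n%:Z - k%:Z) * 'C(k, 2)%:Z) * Dq s.
Proof.
move=> kn us sP sk; set W := Mw _ _; set s' := [seq (n - x)%N | x <- s].
have sn : all (fun x => x <= n)%N s by apply/allP => x /(allP sP) /andP[].
have us' : uniq s'.
  rewrite map_inj_in_uniq // => x y /(allP sP) xP /(allP sP) yP; lia.
have s'k : size s' = k by rewrite size_map.
have s'n : all (fun u => u < n - k + k)%N s'.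
  by rewrite subnK //; apply/allP => x /mapP[y /(allP sP) yP ->]; lia.
have sumE := sum_map_sub sn; rewrite -/s' in sumE.
have := @trap_product F (q ^+ N) q^-1 (n - k) k _ us' s'n s'k; rewrite -/W.
rewrite trap_norm_pairprod => H.
(* The exponents of the denominator are also a reflection, of [1..k] in [k], so that [Vq_rev]
   applies to them. *)
have io : perm_eq (iota 0 k) [seq (k - x)%N | x <- iota 1 k].
  apply: uniq_perm; rewrite ?iota_uniq ?map_inj_in_uniq ?iota_uniq //.
    by move=> x y; rewrite !mem_iota; lia.
  move=> x; rewrite mem_iota; apply/idP/mapP => [xk|[y]]; rewrite ?mem_iota.
    by exists (k - x)%N; rewrite ?mem_iota; lia.
  by move=> yP ->; lia.
have iok : all (fun x => x <= k)%N (iota 1 k).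
  by apply/allP => x; rewrite mem_iota; lia.
have := Vq_rev (iota_uniq 1 k) iok; rewrite -(pairprod_perm _ io) size_iota.
have := Vq_rev us sn; rewrite -/s' sk !Vq_Dq ?iota_uniq // sk size_iota => E1 E2.
set C := 'C(k, 2) in H E1 E2 *.
apply: (mulfI (expf_neq0 C q_neq1)).
apply: (mulfI (expf_neq0 C (expf_neq0 N q0))).
apply: (mulfI (expf_neq0 C (_ : - q ^+ n != 0))); first by rewrite oppr_eq0 expf_neq0.
transitivity ((- q ^+ n) ^+ C * ((q ^+ N) ^+ C * W * ((q - 1) ^+ C * Dq (iota 1 k)))).
  by ring.
rewrite E2.
transitivity ((- q ^+ n) ^+ C * (- q ^+ k) ^+ C * ((q ^+ N) ^+ C * Vinv (iota 0 k) * W)).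
  by ring.
rewrite H.
transitivity ((q ^+ N) ^+ (\sum_(u <- s') u) * (- q ^+ k) ^+ C * ((- q ^+ n) ^+ C * Vinv s')).
  by rewrite /pairprod; ring.
rewrite -E1 [RHS]mulrA [RHS]mulrA [X in _ = X * _]mulrAC.
transitivity ((- q ^+ n) ^+ C * (q ^+ N) ^+ C * q ^ (N%:Z * (n%:Z * k%:Z -
   (\sum_(x <- s) x)%N%:Z - C%:Z) - (n%:Z - k%:Z) * C%:Z) * ((q - 1) ^+ C * Dq s)); last by ring.
congr (_ * _); rewrite ![(- q ^+ _) ^+ C]exprNn mulrCA -!mulrA; congr (_ * _).
rewrite -!exprM !exprnP -!expfzDr //; congr (q ^ _).
have := congr1 Posz sumE; rewrite PoszD PoszM sk => <-.
by rewrite !PoszM; ring.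
Qed.

End ClosedForms.

(** * The dented hexagon *)

Lemma pair_weight_up_down (R : comNzRingType) (v : nat -> R) r j s i :
  pair_weight (wt v) (true, r, j) (false, s, i) =
  if (s == r) && (i == j) then v r
  else if (s == r.+1) && (i == j) || (s == r) && (i.+1 == j) then 1 else 0.
Proof.
rewrite /pair_weight /adj /joined lozengeE [is_lozenge ((false, _, _), _)]lozengeE /= orbF.
case: ifP => [L|]; last by case: ifP; [lia | case: ifP => //; lia].
rewrite L /wt right_lozengeE /=; case: ifP => // N.
by case: ifP => // N'; move: L N N'; lia.
Qed.

Lemma pair_weight_same (R : comNzRingType) (v : nat -> R) u r j s i :
  pair_weight (wt v) (u, r, j) (u, s, i) = 0.
Proof. by rewrite /pair_weight /adj !lozengeE; case: u. Qed.

(** Half-turn of a frame of [h] strips and [n] positions; truncated subtraction makes it faithful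
    only inside the frame. *)
Definition rotation (h n : nat) (t : triangle) : triangle :=
  let: (up, r, j) := t in (~~ up, h.-1 - r, n.-1 - j)%N.

Lemma in_rotation h n a k D up r j : (k <= h)%N -> (a + k <= n)%N ->
  ((up, r, j) \in rotation h n @` trap a k D) =
  [&& r < h, j < n & (~~ up, h.-1 - r, n.-1 - j) \in trap a k D]%N.
Proof.
move=> kh an; apply/imfsetP/idP => [[[[u s] i]] /= tD [-> -> ->]|/and3P[rh jn tD]].
  have [sk ia] : (s < k /\ i < a + k)%N by move: tD; rewrite in_trap; case: u; lia.
  rewrite negbK (_ : (h.-1 - (h.-1 - s) = s)%N); last by lia.
  rewrite (_ : (n.-1 - (n.-1 - i) = i)%N); last by lia.
  by rewrite tD; lia.
exists (~~ up, h.-1 - r, n.-1 - j)%N => //=; rewrite negbK.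
by congr (_, _, _); lia.
Qed.

Lemma label_bounds n (Z : {fset nat}) x : Z `<=` initseg n -> x \in Z -> (0 < x <= n)%N.
Proof. by move=> /fsubsetP ZI /ZI; rewrite in_fset mem_iota; lia. Qed.

Lemma mem_map_succ (S : seq nat) j : (j.+1 \in map succn S) = (j \in S).
Proof. by rewrite mem_map //; exact: succn_inj. Qed.

Section Parts.
Variables (a b c : nat) (X Y : {fset nat}).
Let n := (a + b)%N.
Let h := (b + c)%N.
Notation G := (dented_hexagon a b c X Y).

Lemma in_dented_hexagon up r j : ((up, r, j) \in G) =
  [&& r < h, j < n, j < a + r + up, r < j + b + ~~ up,
    ~~ [&& up, r.+1 == b & j.+1 \in X] & ~~ [&& ~~ up, r == b & j.+1 \in Y]]%N.
Proof.
have hexE : ((up, r, j) \in hexagon a b c) =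
    [&& r < h, j < n, j < a + r + up & r < j + b + ~~ up]%N.
  rewrite /hexagon -/(box (b + c) (a + b)) in_fset inE mem_box /in_hexagon /h /n.
  by case: up => /=; lia.
rewrite in_fset inE hexE /is_up /strip /pos /=.
by rewrite -!andbA.
Qed.

Definition upper_part : region := [fset t in G | (strip t < b)%N].
Definition lower_part : region := [fset t in G | (b <= strip t)%N].

Lemma in_upper_part up r j : ((up, r, j) \in upper_part) =
  [&& r < b, j < a + r + up & ~~ [&& up, r.+1 == b & j.+1 \in X]]%N.
Proof.
rewrite in_fset inE in_dented_hexagon /strip /= /h /n.
by case: up; case: (_ \in X); case: (_ \in Y); lia.
Qed.

Lemma in_lower_part up r j : ((up, r, j) \in lower_part) =
  [&& b <= r, r < h, j < n, r < j + b + ~~ up & ~~ [&& ~~ up, r == b & j.+1 \in Y]]%N.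
Proof.
rewrite in_fset inE in_dented_hexagon /strip /= /h /n.
by case: up; case: (_ \in X); case: (_ \in Y); lia.
Qed.

Lemma upper_lower : G = upper_part `|` lower_part.
Proof.
apply/fsetP => -[[up r] j]; rewrite in_fsetU in_upper_part in_lower_part.
rewrite in_dented_hexagon /h /n.
by case: up; case: (_ \in X); case: (_ \in Y); lia.
Qed.

End Parts.

(** * Cutting the hexagon along its horizontal diagonal *)

Section Cut.
Variables (F : fieldType) (q : F).
Hypothesis (q0 : q != 0).
Notation wq := (wt (fun r => q ^+ r.+1)).

(** The half-turn preserves right-lozenges and moves strip [r] to [h.-1 - r], where their weight is
    [q ^+ (h - r)]. *)
Lemma Mw_rotation h n a k D : (k <= h)%N -> (a + k <= n)%N ->
  Mw wq (rotation h n @` trap a k D) =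
  Mw (wt (fun r => q ^+ h * q^-1 ^+ r)) (trap a k D).
Proof.
move=> kh an.
have bound u r j : (u, r, j) \in trap a k D -> (r < h /\ j < n)%N.
  by rewrite in_trap; case: u; lia.
apply: Mw_imfset => -[[u r] j] [[u' s] i] /bound[rh jn] /bound[sh si].
  by case=> /negb_inj -> rs ji; congr (_, _, _); lia.
have E m : (m < h)%N -> q ^+ (h.-1 - m).+1 = q ^+ h * q^-1 ^+ m.
  move=> mh; rewrite (_ : h = (h.-1 - m).+1 + m)%N; last by lia.
  by rewrite [in RHS]exprD exprVn mulfK ?expf_neq0 //; congr (q ^+ _); lia.
have main r1 j1 s1 i1 : (r1 < h)%N -> (s1 < h)%N -> (j1 < n)%N -> (i1 < n)%N ->
    pair_weight wq (true, h.-1 - s1, n.-1 - i1)%N (false, h.-1 - r1, n.-1 - j1)%N =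
    pair_weight (wt (fun r => q ^+ h * q^-1 ^+ r)) (true, r1, j1) (false, s1, i1).
  move=> r1h s1h j1n i1n; rewrite !pair_weight_up_down E //.
  have -> : (h.-1 - r1 == h.-1 - s1)%N && (n.-1 - j1 == n.-1 - i1)%N
     = (s1 == r1) && (i1 == j1) by lia.
  case: ifP => [/andP[/eqP-> _]//|_]; congr (if _ then _ else _); lia.
case: u; case: u'; rewrite ?pair_weight_same //=; first by rewrite pair_weightC main.
by rewrite main // pair_weightC.
Qed.

Variables (a b c : nat) (X Y : {fset nat}).
Let n := (a + b)%N.
Let h := (b + c)%N.
Hypotheses (cn : (c <= n)%N) (XI : X `<=` initseg n) (YI : Y `<=` initseg n).
Notation G := (dented_hexagon a b c X Y).

(** A triangle used by a crossing lozenge acts as an additional dent; [predn] turns labels, which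
    start at 1, into positions. *)
Lemma upper_partE (S : seq nat) :
  upper_part a b c X Y `\` [fset (true, b.-1, j) | j in S] =
  trap a b (map predn (X ++ map succn S)).
Proof.
have mD j : (j \in map predn (X ++ map succn S)) = (j.+1 \in X) || (j \in S).
  rewrite map_cat mem_cat -map_comp map_id; congr (_ || _).
  apply/mapP/idP => [[x xX ->]|jX]; last by exists j.+1.
  by have /andP[x0 _] := label_bounds XI xX; rewrite prednK.
apply/fsetP => -[[up r] j]; rewrite in_fsetD in_upper_part in_trap mD.
have -> : ((up, r, j) \in [fset (true, b.-1, j) | j in S]) = [&& up, r == b.-1 & j \in S].
  apply/imfsetP/and3P => [[i /= iS [-> -> ->]]|[-> /eqP-> jS]]; first by [].
  by exists j.
by case: up; case: (_ \in X); case: (j \in S); lia.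
Qed.

(** The segment labelled [x] has position [x.-1], which the half-turn moves to [n - x]. *)
Lemma lower_partE (S : seq nat) : all (fun j => j < n)%N S ->
  lower_part a b c X Y `\` [fset (false, b, j) | j in S] =
  rotation h n @` trap (n - c) c [seq (n - x)%N | x <- Y ++ map succn S].
Proof.
move=> Sn; have mD j : (j < n)%N ->
    (n.-1 - j \in [seq (n - x)%N | x <- Y ++ map succn S])%N = (j.+1 \in Y) || (j \in S).
  move=> jn; rewrite map_cat mem_cat -map_comp; congr (_ || _).
    apply/mapP/idP => [[x xY E]|jX]; last by exists j.+1; rewrite //; lia.
    by have := label_bounds YI xY => xP; rewrite (_ : j.+1 = x) //; lia.
  apply/mapP/idP => [[x xS /= E]|jX]; last by exists j; rewrite //=; lia.
  by have := allP Sn _ xS => xn; rewrite (_ : j = x) //; lia.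
apply/fsetP => -[[up r] j]; rewrite in_fsetD in_lower_part in_rotation; first last.
- by rewrite subnK.
- exact: leq_addl.
have -> : ((up, r, j) \in [fset (false, b, j) | j in S]) = [&& ~~ up, r == b & j \in S].
  apply/imfsetP/and3P => [[i /= iS [-> -> ->]]|[/negPf-> /eqP-> jS]]; first by [].
  by exists j.
rewrite in_trap /h; have [jn|jn] := ltnP j n; last by lia.
by rewrite mD //; case: up; case: (_ \in Y); case: (j \in S); rewrite /=; lia.
Qed.

Definition free_segments : seq nat :=
  [seq j <- iota 0 n | (j.+1 \notin X) && (j.+1 \notin Y)].

(** A lozenge can cross the diagonal only if there are strips on both sides, so for [b = 0] or
    [c = 0] no segment is available. *)
Lemma Mw_cut_hexagon : Mw wq G =
  \sum_(S <- subs (if (0 < b)%N && (0 < c)%N then free_segments else [::]))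
    Mw (wt (fun r => q * q ^+ r)) (trap a b (map predn (X ++ map succn S))) *
    Mw (wt (fun r => q ^+ h * q^-1 ^+ r))
       (trap (n - c) c [seq (n - x)%N | x <- Y ++ map succn S]).
Proof.
set J := if _ then _ else _.
have Jsub S j : S \in subs J -> j \in S -> (j < n)%N.
  move=> /subs_subseq /mem_subseq SJ /SJ; rewrite /J; case: ifP => // _.
  by rewrite mem_filter mem_iota => /andP[_ /andP[]].
rewrite upper_lower (@Mw_cut _ (fun j => (true, b.-1, j)) (fun j => (false, b, j)) _ _ _ J).
- rewrite big_seq [RHS]big_seq; apply: eq_bigr => S SJ.
  rewrite upper_partE lower_partE; last by apply/allP => j; apply: Jsub SJ.
  rewrite Mw_rotation ?leq_addl ?subnK //; congr (_ * _).
  by apply: Mw_ext => l _; rewrite /wt exprS.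
- by move=> i j [].
- by move=> i j [].
- by rewrite /J; case: ifP => // _; rewrite filter_uniq ?iota_uniq.
- by move=> [[up r] j]; rewrite in_upper_part in_lower_part; lia.
- move=> j; rewrite /J; case: ifP => // /andP[b0 c0].
  rewrite mem_filter mem_iota => /andP[/andP[jX jY] /andP[_ jn]].
  split.
  + by rewrite in_upper_part (negPf jX); lia.
  + by rewrite in_lower_part (negPf jY) /h; lia.
  + by rewrite lozengeE; lia.
  + by rewrite /wt right_lozengeE gtn_eqF // prednK.
move=> [[[] r] j] [[[] s] i]; rewrite ?pair_weight_same ?eqxx // in_upper_part in_lower_part.
  rewrite pair_weight_up_down => aA bB; have [|_] := boolP ((s == r) && (i == j)); first by lia.
  case: ifP => [E _|]; last by rewrite eqxx.
  have [sE rE ij] : [/\ s = b, r = b.-1 & i = j].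
    by move: aA bB E; rewrite /h; split; lia.
  subst s r i; exists j => //.
  have -> : J = free_segments.
    rewrite /J (_ : (0 < b)%N && (0 < c)%N) //.
    by move: aA bB; rewrite /h; lia.
  rewrite mem_filter mem_iota; move: aA bB; rewrite /h.
  by case: (_ \in X); case: (_ \in Y); lia.
rewrite pair_weightC pair_weight_up_down => aA bB.
have [|_] := boolP ((r == s) && (j == i)); first by lia.
by case: ifP => [E _|]; [move: aA bB E; rewrite /h; lia | rewrite eqxx].
Qed.

End Cut.

(** * Generating function of the dented hexagon *)

Lemma sum_subs_nil (R : nmodType) (T : Type) (s : seq T) (f : seq T -> R) :
  \sum_(S <- subs s | size S == 0%N) f S = f [::].
Proof.
elim: s => [|x s IH] /=; first by rewrite big_mkcond big_seq1.
by rewrite big_cat big_map /= big_pred0 // add0r.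
Qed.

Lemma Mw_rmorph (R S : comNzRingType) (f : {rmorphism R -> S}) w G :
  f (Mw w G) = Mw (f \o w) G.
Proof. by rewrite rmorph_sum; apply: eq_bigr => T _; rewrite rmorph_prod. Qed.

Lemma divz2 (x : int) y : x = 2 * y -> (x %/ 2)%Z = y.
Proof. by move->; rewrite mulKz. Qed.

Lemma bin2z k : 2 * 'C(k, 2)%:Z = k%:Z * (k%:Z - 1).
Proof.
case: k => [|k] //; rewrite -[2]/(2%:Z) -PoszM -mul_bin_diag bin1 PoszM.
by congr (_ * _); lia.
Qed.

(** The right side adds the exponents of [trap_upper] and [trap_lower] for the dents [X] and [Y],
    with [N = b + c] and [n = a + b]. *)
Lemma exponentE (a b c : nat) (X Y : {fset nat}) :
  exponent a b c X Y =
  (\sum_(i <- X) i)%N%:Z - (b + c)%N%:Z * (\sum_(j <- Y) j)%N%:Z - 'C(b.+1, 2)%:Z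
  + (b + c)%N%:Z * ((a + b)%N%:Z * c%:Z - 'C(c, 2)%:Z)
  - ((a + b)%N%:Z - c%:Z) * 'C(c, 2)%:Z.
Proof.
rewrite /exponent.
have -> : \sum_(i <- X) i%:Z = (\sum_(i <- X) i)%N%:Z
  by rewrite (big_morph Posz PoszD (erefl (Posz 0))).
have -> : \sum_(i <- Y) i%:Z = (\sum_(i <- Y) i)%N%:Z
  by rewrite (big_morph Posz PoszD (erefl (Posz 0))).
have Cb := bin2z b; have Cc := bin2z c.
rewrite (@divz2 _ ('C(b, 2)%:Z + b%:Z)); last by rewrite [RHS]mulrDr Cb; ring.
rewrite (@divz2 _ ((b%:Z + 1) * ('C(c, 2)%:Z + c%:Z))); last first.
  by rewrite [RHS]mulrCA [2 * (_ + _)]mulrDr Cc; ring.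
rewrite (@divz2 _ ((a%:Z + b%:Z + 1) * 'C(c, 2)%:Z)); last by rewrite [RHS]mulrCA Cc; ring.
(* To [ring] the binomial is an atom unrelated to [c * c]; the steps below expose the product to be
   replaced. *)
have Cc' : c%:Z * c%:Z = 2 * 'C(c, 2)%:Z + c%:Z by rewrite Cc; ring.
rewrite binS bin1 !PoszD.
transitivity ((\sum_(i <- X) i)%N%:Z - (b%:Z + c%:Z) * (\sum_(j <- Y) j)%N%:Z
  - ('C(b, 2)%:Z + b%:Z) + (a%:Z + b%:Z) * (b%:Z * c%:Z)
  + (a%:Z + b%:Z) * 'C(c, 2)%:Z + (a%:Z + b%:Z) * c%:Z - b%:Z * 'C(c, 2)%:Z); first by ring.
transitivity ((\sum_(i <- X) i)%N%:Z - (b%:Z + c%:Z) * (\sum_(j <- Y) j)%N%:Z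
  - ('C(b, 2)%:Z + b%:Z) + (a%:Z + b%:Z) * (b%:Z * c%:Z)
  + (a%:Z + b%:Z) * (c%:Z * c%:Z) - (a%:Z + b%:Z) * 'C(c, 2)%:Z - b%:Z * 'C(c, 2)%:Z);
  last by ring.
by rewrite Cc'; ring.
Qed.

Section Hexagon.
Variables (F : fieldType) (q : F).
Hypotheses (q0 : q != 0) (q_inj : forall x y, (x < y)%N -> q ^+ y != q ^+ x).
Variables (a b c m : nat) (X Y : {fset nat}).
Let n := (a + b)%N.
Hypotheses (cn : (c <= n)%N) (XI : X `<=` initseg n) (YI : Y `<=` initseg n).
Hypotheses (Xb : (#|` X| + m = b)%N) (Yc : (#|` Y| + m = c)%N).
Notation wq := (wt (fun r => q ^+ r.+1)).
Notation Dq := (pairprod (fun x y => qint q y - qint q x)).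
Notation free := (free_segments a b X Y).

Let upper S := Mw (wt (fun r => q * q ^+ r)) (trap a b (map predn (X ++ map succn S))).
Let lower S := Mw (wt (fun r => q ^+ (b + c) * q^-1 ^+ r))
       (trap (n - c) c [seq (n - x)%N | x <- Y ++ map succn S]).

Lemma free_dents (Z : {fset nat}) S : Z `<=` initseg n -> (Z = X \/ Z = Y) ->
  S \in subs free ->
  uniq (Z ++ map succn S) /\ all (fun x => 0 < x <= n)%N (Z ++ map succn S).
Proof.
move=> ZI ZXY /subs_subseq SJ; have /mem_subseq SJm := SJ; split.
  rewrite cat_uniq fset_uniq /= map_inj_uniq; last exact: succn_inj.
  rewrite (subseq_uniq SJ) ?filter_uniq ?iota_uniq // andbT.
  apply/hasPn => x /mapP[j /SJm]; rewrite mem_filter => /andP[/andP[jX jY] _] ->.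
  by case: ZXY => ->.
rewrite all_cat; apply/andP; split; first by apply/allP => x xZ; exact: label_bounds ZI xZ.
by apply/allP => x /mapP[j /SJm]; rewrite mem_filter mem_iota => /andP[_ jn] ->; lia.
Qed.

(** A crossing set of size other than [m] unbalances the upper trapezoid and contributes 0. If
    [b = 0] or [c = 0], then [m = 0] and only the empty set occurs. *)
Lemma Mw_hexagon :
  Mw wq (dented_hexagon a b c X Y) =
  \sum_(S <- subs free | size S == m) upper S * lower S.
Proof.
rewrite Mw_cut_hexagon //; case: ifP => [/andP[b0 c0]|bc0].
  rewrite [RHS]big_mkcond big_seq [RHS]big_seq; apply: eq_bigr => S SJ.
  case: eqP => // Sm; have [uS nS] := free_dents XI (or_introl erefl) SJ.
  rewrite trap_unbalanced_uniq ?mul0r //.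
  - rewrite map_inj_in_uniq // => x y /(allP nS) xP /(allP nS) yP; lia.
  - by apply/allP => x /mapP[y /(allP nS) yP ->]; rewrite -/n; lia.
  - by rewrite size_map size_cat size_map; apply/eqP => E; apply: Sm; apply: (@addnI (size X));
    rewrite E; exact/esym/Xb.
have -> : m = 0%N by lia.
by rewrite sum_subs_nil big_seq1.
Qed.

Lemma upper_lowerE S : S \in subs free -> size S = m ->
  upper S * lower S * (Dq (iota 1 b) * Dq (iota 1 c)) =
  q ^ (exponent a b c X Y + ((\sum_(x <- map succn S) x)%N%:Z
        - (b + c)%N%:Z * (\sum_(x <- map succn S) x)%N%:Z))
  * (Dq (X ++ map succn S) * Dq (Y ++ map succn S)).
Proof.
move=> SJ Sm; have [uX nX] := free_dents XI (or_introl erefl) SJ.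
have [uY nY] := free_dents YI (or_intror erefl) SJ.
have sX : size (X ++ map succn S) = b by rewrite size_cat size_map Sm.
have sY : size (Y ++ map succn S) = c by rewrite size_cat size_map Sm.
have U := trap_upper q0 q_inj uX nX sX.
have L := trap_lower q0 q_inj (b + c) cn uY nY sY.
transitivity ((upper S * Dq (iota 1 b)) * (lower S * Dq (iota 1 c))); first by ring.
rewrite /upper /lower U L mulrACA -expfzDr //; congr (q ^ _ * _).
by rewrite exponentE !big_cat /= !PoszD -/n; ring.
Qed.

(** The power of [q] inside the sum depends only on [S] and [b + c], both of which two shuffled
    hexagons share. *)
Lemma Mw_hexagon_formula :
  Mw wq (dented_hexagon a b c X Y) * (Dq (iota 1 b) * Dq (iota 1 c)) =
  q ^ (exponent a b c X Y) *
  \sum_(S <- subs free | size S == m)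
     q ^ ((\sum_(x <- map succn S) x)%N%:Z - (b + c)%N%:Z * (\sum_(x <- map succn S) x)%N%:Z)
     * (Dq (X ++ map succn S) * Dq (Y ++ map succn S)).
Proof.
rewrite Mw_hexagon big_distrl big_distrr /= big_seq_cond [RHS]big_seq_cond.
apply: eq_bigr => S /andP[SJ /eqP Sm]; rewrite upper_lowerE //.
by rewrite expfzDr // mulrA.
Qed.

End Hexagon.

(** * Non-vanishing, and the depth of the top line *)

Lemma Mw_wt_ge0 (R : realDomainType) (v : nat -> R) G :
  (forall r, 0 <= v r) -> 0 <= Mw (wt v) G.
Proof.
move=> v0; apply: sumr_ge0 => T _; apply: prodr_ge0 => l _.
by rewrite /wt; case: ifP.
Qed.

(** For [q > 1] all summands are nonnegative, and the closed form shows that the one for the first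
    [m] free segments is nonzero. *)
Lemma Mw_hexagon_neq0 (R : realFieldType) (q : R) a b c m (X Y : {fset nat}) :
  1 < q -> (c <= a + b)%N -> X `<=` initseg (a + b) -> Y `<=` initseg (a + b) ->
  (#|` X| + m = b)%N -> (#|` Y| + m = c)%N ->
  (m <= size (free_segments a b X Y))%N ->
  Mw (wt (fun r => q ^+ r.+1)) (dented_hexagon a b c X Y) != 0.
Proof.
move=> q1 cn XI YI Xb Yc mf; have qgt0 : 0 < q := lt_trans ltr01 q1.
have q0 : q != 0 by rewrite gt_eqF.
have q_inj x y : (x < y)%N -> q ^+ y != q ^+ x.
  by move=> xy; rewrite gt_eqF // ltr_eXn2l.
rewrite (Mw_hexagon q0 cn XI YI Xb Yc) psumr_eq0 => [|S _]; last first.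
  by rewrite mulr_ge0 // Mw_wt_ge0 // => r;
    rewrite mulr_ge0 ?exprn_ge0 ?invr_ge0 // ltW.
apply/allPn; exists (take m (free_segments a b X Y)); first exact: take_in_subs.
have Sm : size (take m (free_segments a b X Y)) = m by rewrite size_takel.
rewrite Sm eqxx /=; have := upper_lowerE q0 q_inj cn XI YI Xb Yc (take_in_subs _ _) Sm.
move=> E; apply/eqP => T0; move: E; rewrite T0 mul0r => /esym/eqP.
by rewrite !mulf_eq0 expfz_eq0 (negPf q0) andbF !(negPf (Dq_neq0 q_inj _)).
Qed.

(** Puts the line from which weights are measured at depth 0. Dents touch strip 0 only if [b <= 1],
    and when nothing remains there the whole region is empty. *)
Lemma strip0_in_hexagon a b c m (X Y : {fset nat}) t :
  (c <= a + b)%N -> X `<=` initseg (a + b) -> Y `<=` initseg (a + b) ->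
  (#|` X| + m = b)%N -> (#|` Y| + m = c)%N ->
  t \in dented_hexagon a b c X Y ->
  exists2 t0, t0 \in dented_hexagon a b c X Y & strip t0 = 0%N.
Proof.
move=> cn XI YI Xb Yc tG.
have one (Z : {fset nat}) : Z `<=` initseg 1 -> (0 < #|` Z|)%N -> 1%N \in Z.
  move=> ZI; rewrite cardfs_gt0 => /fset0Pn[x xZ].
  by have := label_bounds ZI xZ; case: x xZ => [|[|x]].
case: (ltnP 1 b) => [b2|b1].
  by exists (true, 0%N, 0%N); rewrite // in_dented_hexagon; lia.
have [b_eq1|b_neq1] := eqVneq b 1%N.
  have [a0|a0] := posnP a; last first.
    by exists (false, 0%N, 0%N); rewrite // in_dented_hexagon; lia.
  have [X1|X1] := boolP (1%N \in X); last first.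
    by exists (true, 0%N, 0%N); rewrite // in_dented_hexagon (negPf X1); lia.
  have Xs : (0 < #|` X|)%N by rewrite cardfs_gt0; apply/fset0Pn; exists 1%N.
  (* The diagonal is a single segment. As [X] fills it, [m = 0], so [Y] fills it too if [c > 0], and
     no triangle is left. *)
  exfalso; rewrite a0 b_eq1 in YI tG Xb.
  have Y1 : (0 < c)%N -> 1%N \in Y by move=> c0; apply: one => //; lia.
  case: t tG => [[up r] j]; rewrite in_dented_hexagon.
  case: j => [|j]; last by lia.
  case: up; first by case: r => [|r]; rewrite ?X1; lia.
  by case: r => [|[|r]]; try lia; have [c0|/Y1->] := posnP c; lia.
have b0 : b = 0%N by lia.
have [n1|n1] := ltnP 1 a.
  exists (true, 0%N, 1%N); rewrite // in_dented_hexagon.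
  by case: t tG => [[up r] j]; rewrite in_dented_hexagon; lia.
(* The hexagon is now a single down-pointing triangle, which [Y] removes. *)
exfalso; case: t tG => [[up r] j]; rewrite in_dented_hexagon => tG.
have [a1 c1] : a = 1%N /\ c = 1%N by lia.
rewrite a1 b0 c1 in YI tG Xb Yc; have Y1 : 1%N \in Y by apply: one => //; lia.
have [r0 j0] : r = 0%N /\ j = 0%N by lia.
by move: tG; rewrite r0 j0 Y1; case: up.
Qed.

Lemma bigmin_leq (T : eqType) (s : seq T) (f : T -> nat) i0 x : x \in s ->
  (\big[minn/i0]_(t <- s) f t <= f x)%N.
Proof.
elim: s => // y s IH; rewrite inE big_cons => /orP[/eqP->|/IH]; first exact: geq_minl.
exact: leq_trans (geq_minr _ _).
Qed.

Lemma M_wt a b c m (X Y : {fset nat}) :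
  (c <= a + b)%N -> X `<=` initseg (a + b) -> Y `<=` initseg (a + b) ->
  (#|` X| + m = b)%N -> (#|` Y| + m = c)%N ->
  M (dented_hexagon a b c X Y) = Mw (wt (fun r => q ^+ r.+1)) (dented_hexagon a b c X Y).
Proof.
move=> cn XI YI Xb Yc; apply: Mw_ext => l; rewrite in_lozenges => /and3P[_ l1 _].
have [t0 t0G st0] := strip0_in_hexagon cn XI YI Xb Yc l1.
have top0 : top_line (dented_hexagon a b c X Y) = 0%N.
  by apply/eqP; rewrite -leqn0 -st0; apply: bigmin_leq.
by rewrite /lozenge_weight /wt top0 subn0.
Qed.

Lemma q_neq0 : q != 0.
Proof. by rewrite /q tofrac_eq0 polyX_eq0. Qed.

Lemma q_exp_inj x y : (x < y)%N -> q ^+ y != q ^+ x.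
Proof.
move=> xy; rewrite /q -!tofracXn tofrac_eq.
apply/eqP => /(congr1 (fun p : {poly rat} => size p)).
by rewrite !size_polyXn => -[E]; rewrite E ltnn in xy.
Qed.

(* A vanishing generating function would also vanish at [q = 2]. *)
Lemma M_neq0 a b c m (X Y : {fset nat}) :
  (c <= a + b)%N -> X `<=` initseg (a + b) -> Y `<=` initseg (a + b) ->
  (#|` X| + m = b)%N -> (#|` Y| + m = c)%N ->
  (m <= size (free_segments a b X Y))%N ->
  M (dented_hexagon a b c X Y) != 0.
Proof.
move=> cn XI YI Xb Yc mf; set G := dented_hexagon _ _ _ _ _.
(* Evaluation at 2 is a morphism on polynomials but not on fractions, hence the detour through
   [{poly rat}]. *)
have poly_neq0 : Mw (wt (fun r => 'X ^+ r.+1 : {poly rat})) G != 0.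
  have := @Mw_hexagon_neq0 rat 2 _ _ _ _ _ _ isT cn XI YI Xb Yc mf.
  apply: contraNneq => P0; rewrite -(rmorph0 (horner_eval (2 : rat))) -P0 Mw_rmorph.
  apply/eqP/Mw_ext => l _ /=; rewrite /wt; case: ifP => _; last by rewrite rmorph1.
  by rewrite rmorphXn /= /horner_eval hornerX.
rewrite (M_wt cn XI YI Xb Yc); apply: contraNneq poly_neq0 => M0.
rewrite -tofrac_eq0 -M0 Mw_rmorph; apply/eqP/Mw_ext => l _ /=.
by rewrite /wt; case: ifP => _; rewrite ?rmorphXn ?rmorph1.
Qed.

(** * Comparison of two shuffled hexagons *)

Lemma Delta_pairprod (S : {fset nat}) s : perm_eq S s ->
  Delta S = pairprod (fun x y => qint q y - qint q x) s.
Proof. exact: pairprod_perm. Qed.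

Lemma perm_initseg k : perm_eq (initseg k) (iota 1 k).
Proof.
by apply: uniq_perm; rewrite ?fset_uniq ?iota_uniq // => x; rewrite in_fset.
Qed.

(** Union and intersection together determine the multiplicity of each element in the
    concatenation. *)
Lemma shuffling_perm (X Y X' Y' : {fset nat}) : shuffling X' Y' X Y ->
  perm_eq (X ++ Y) (X' ++ Y').
Proof.
case=> /fsetP EU /fsetP EI; apply/allP => x _ /=; apply/eqP.
rewrite !count_cat !count_uniq_mem ?fset_uniq //.
move: (EU x) (EI x); rewrite !inE.
by case: (x \in X); case: (x \in Y); case: (x \in X'); case: (x \in Y').
Qed.

Lemma shuffling_free a b a' b' (X Y X' Y' : {fset nat}) :
  (a + b = a' + b')%N -> shuffling X' Y' X Y ->
  free_segments a b X Y = free_segments a' b' X' Y'.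
Proof.
move=> ab [/fsetP EU _]; rewrite /free_segments ab; apply: eq_filter => j.
by rewrite -!negb_or -!in_fsetU EU.
Qed.

Lemma card_free a b (X Y : {fset nat}) :
  #|` initseg (a + b) `\` (X `|` Y)| = size (free_segments a b X Y).
Proof.
rewrite -(size_map succn); apply: perm_size; apply: uniq_perm.
- exact: fset_uniq.
- by rewrite (map_inj_uniq succn_inj) filter_uniq ?iota_uniq.
move=> x; rewrite in_fsetD in_fsetU (perm_mem (perm_initseg _)) mem_iota negb_or.
case: x => [|j]; first by rewrite andbF; apply/esym/negP => /mapP[].
by rewrite mem_map_succ mem_filter mem_iota.
Qed.

Lemma ratio_of_sums (F : fieldType) (m m' s s' Q Q' B B' D D' : F) :
  Q != 0 -> B != 0 -> B' != 0 -> D != 0 -> m != 0 ->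
  m * B = Q * s -> m' * B' = Q' * s' -> s * D' = s' * D ->
  m' / m = Q' * Q^-1 * (B / B') * (D' / D).
Proof.
move=> Q0 B0 B'0 D0 m0 E E' ss.
have -> : m' = Q' * (s * D' / D) / B' by rewrite ss mulfK // -E' mulfK.
have -> : s = m * B / Q by rewrite E mulrAC mulfV // mul1r.
by field; rewrite Q0 D0 B'0 m0.
Qed.

Theorem theorem4p1 (a b c a' b' c' : nat) (X Y X' Y' : {fset nat})
  (hX : X `<=` initseg (a + b)) (hY : Y `<=` initseg (a + b))
  (hX' : X' `<=` initseg (a' + b')) (hY' : Y' `<=` initseg (a' + b'))
  (hshuffling : shuffling X' Y' X Y)
  (hab : (a + b = a' + b')%N) (hbc : (b + c = b' + c')%N)
  (hc : (c <= a + b)%N) (hc' : (c' <= a' + b')%N)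
  (hXY : b%:Z - #|` X|%:Z = c%:Z - #|` Y|%:Z)
  (hYX' : c%:Z - #|` Y|%:Z = b'%:Z - #|` X'|%:Z)
  (hXY' : b'%:Z - #|` X'|%:Z = c'%:Z - #|` Y'|%:Z)
  (hge0 : 0 <= c'%:Z - #|` Y'|%:Z)
  (hfree : b%:Z - #|` X|%:Z <= #|` initseg (a + b) `\` (X `|` Y)|%:Z) :
  M (dented_hexagon a' b' c' X' Y') / M (dented_hexagon a b c X Y) =
  q ^ (exponent a' b' c' X' Y' - exponent a b c X Y)
  * (Delta (initseg b) * Delta (initseg c)
     / (Delta (initseg b') * Delta (initseg c')))
  * (Delta X' * Delta Y' / (Delta X * Delta Y)).
Proof.
(* The number of vertical lozenges crossing the diagonal, the same in both hexagons. *)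
pose m := (b - #|` X|)%N.
have Xb : (#|` X| + m = b)%N by rewrite /m; lia.
have Yc : (#|` Y| + m = c)%N by rewrite /m; lia.
have Xb' : (#|` X'| + m = b')%N by rewrite /m; lia.
have Yc' : (#|` Y'| + m = c')%N by rewrite /m; lia.
have mf : (m <= size (free_segments a b X Y))%N by rewrite -card_free /m; lia.
have M0 := M_neq0 hc hX hY Xb Yc mf.
have DE S : Delta S = pairprod (fun x y => qint q y - qint q x) S := Delta_pairprod (perm_refl _).
have D0 S : Delta S != 0 by rewrite DE; exact: (Dq_neq0 q_exp_inj).
have := Mw_hexagon_formula q_neq0 q_exp_inj hc' hX' hY' Xb' Yc'.
have := Mw_hexagon_formula q_neq0 q_exp_inj hc hX hY Xb Yc.
rewrite -(M_wt hc hX hY Xb Yc) -(M_wt hc' hX' hY' Xb' Yc').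
rewrite -!(Delta_pairprod (perm_initseg _)) -(shuffling_free hab hshuffling) -hbc.
set s := \sum_(_ <- _ | _) _; set s' := \sum_(_ <- _ | _) _ => E E'.
(* Both sums run over the same sets with the same powers of [q], so the comparison is term by
   term. *)
have ss : s * (Delta X' * Delta Y') = s' * (Delta X * Delta Y).
  rewrite !DE !big_distrl; apply: eq_bigr => S _; rewrite -[LHS]mulrA -[RHS]mulrA.
  by congr (_ * _); apply: pairprod_shuffle; apply: shuffling_perm.
have D2 S T : Delta S * Delta T != 0 := mulf_neq0 (D0 S) (D0 T).
rewrite (expfzDr _ _ q_neq0) -invr_expz.
exact: (ratio_of_sums (expfz_neq0 _ q_neq0) (D2 _ _) (D2 _ _) (D2 _ _) M0 E E' ss).
Qed.
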